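(* Given the suffix tree for a string $S[1..n]$, we can build the position heap for $S$ (including its node labels, edge labels and maximal-reach pointers) in $O(n)$ time, independent of the size of the alphabet.
   Context: Model: word RAM. $S[1..n]$ is a string whose last character $S[n]=\$$ is a special end symbol occurring nowhere else; $S[i..n]$ denotes its suffix starting at position $i$. The suffix tree of $S$ is the compacted trie of all suffixes of $S$, with each leaf labelled by the starting position of the suffix it represents. The position heap of $S$ is the trie obtained as follows: start with a root labelled $0$ (path label the empty string); for $i = 1, \dots, n$ in order, add a new node labelled $i$ whose path label (the concatenation of edge labels from the root) is the shortest prefix of $S[i..n]$ that is not already the path label of a node in the trie. In addition, the node labelled $i$ stores a maximal-reach pointer to the deepest node of the trie whose path label is a prefix of $S[i..n]$. *)

(* Defs.v *)
From Stdlib Require Import PeanoNat.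
From mathcomp Require Import all_boot.
Set Implicit Arguments. Unset Strict Implicit. Unset Printing Implicit Defensive.

(* Strings over an integer alphabet: S : seq nat, S[1..n], 1-indexed.  *)

Definition suffix_at (S : seq nat) (i : nat) : seq nat := drop i.-1 S.

Definition end_marked (S : seq nat) : bool :=
  (0 < size S) && (last 0 S \notin take (size S).-1 S).

Definition suffixes_of (S : seq nat) : seq (seq nat) :=
  [seq suffix_at S i | i <- iota 1 (size S)].

(* A trie node (prefix of a string of L) survives compaction iff it is *)
(* the root, one of the strings of L, or has >= 2 children.            *)

Definition is_trie_prefix (L : seq (seq nat)) (x : seq nat) : Prop :=
  exists2 s, s \in L & prefix x s.

Definition ctrie_node (L : seq (seq nat)) (x : seq nat) : Prop :=
  is_trie_prefix L x /\
  (x = [::] \/ x \in L \/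
   exists a b, a <> b /\ is_trie_prefix L (rcons x a) /\ is_trie_prefix L (rcons x b)).

Definition ctrie_parent (L : seq (seq nat)) (y x : seq nat) : Prop :=
  ctrie_node L y /\ prefix y x /\ size y < size x /\
  forall z, ctrie_node L z -> prefix z x -> size z < size x -> size z <= size y.

(* pheap S i = list of path labels of nodes labelled 0..i (entry j is  *)
(* the path label of the node labelled j).                             *)

Definition ph_insert (S : seq nat) (H : seq (seq nat)) (i : nat) :=
  let s := suffix_at S i in
  let k := find (fun k => take k s \notin H) (iota 0 (size s).+1) in
  rcons H (take k s).

Fixpoint pheap (S : seq nat) (i : nat) : seq (seq nat) :=
  match i with
  | 0 => [:: [::]]
  | i'.+1 => ph_insert S (pheap S i') i'.+1
  end.

Definition ph_label (S : seq nat) (j : nat) : seq nat :=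
  nth [::] (pheap S (size S)) j.

(* Word RAM with word size w: memory cells hold words (< 2^w).          *)

Inductive instr :=
| IConst (a k : nat)
| IAdd (a b c : nat)
| ISub (a b c : nat)
| IMul (a b c : nat)
| IDiv (a b c : nat)            (* M[a] := M[b] / M[c] (0 if M[c]=0) *)
| IAnd (a b c : nat) | IOr (a b c : nat) | IXor (a b c : nat)
| IShl (a b c : nat)
| IShr (a b c : nat)
| ILoad (a b : nat)
| IStore (a b : nat)
| IJlt (a b t : nat)
| IJmp (t : nat)
| IHalt.

Record state := State { pc : nat; memory : nat -> nat }.

Definition upd (M : nat -> nat) (a v : nat) : nat -> nat :=
  fun x => if x == a then v else M x.

Definition step (w : nat) (P : seq instr) (s : state) : state :=
  let M := memory s in
  let W := 2 ^ w in
  let nx := (pc s).+1 in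
  match nth IHalt P (pc s) with
  | IConst a k => State nx (upd M a (k %% W))
  | IAdd a b c => State nx (upd M a ((M b + M c) %% W))
  | ISub a b c => State nx (upd M a ((M b + (W - M c %% W)) %% W))
  | IMul a b c => State nx (upd M a ((M b * M c) %% W))
  | IDiv a b c => State nx (upd M a (M b %/ M c))
  | IAnd a b c => State nx (upd M a (Nat.land (M b) (M c)))
  | IOr a b c => State nx (upd M a (Nat.lor (M b) (M c)))
  | IXor a b c => State nx (upd M a (Nat.lxor (M b) (M c)))
  | IShl a b c => State nx (upd M a ((M b * 2 ^ M c) %% W))
  | IShr a b c => State nx (upd M a (M b %/ 2 ^ M c))
  | ILoad a b => State nx (upd M a (M (M b)))
  | IStore a b => State nx (upd M (M a) (M b))
  | IJlt a b t => State (if M a < M b then t else nx) M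
  | IJmp t => State t M
  | IHalt => s
  end.

Definition halted (P : seq instr) (s : state) : bool :=
  if nth IHalt P (pc s) is IHalt then true else false.

Definition run (w : nat) (P : seq instr) (t : nat) (s : state) : state :=
  iter t (step w P) s.

(* M[0] = n, M[1] = m (number of suffix-tree nodes, numbered 0..m-1,   *)
(* root = 0; 0 also serves as NIL since the root is nobody's child),   *)
(* M[16+i] = S[i+1] for i < n, and node v has a record at              *)
(* rec v = 16 + n + 6 v with fields                                    *)
(*   +0 parent, +1 first child, +2 next sibling (children in ANY order),*)
(*   +3 start position st and +4 length len of the edge label          *)
(*      S[st..st+len-1] of the edge entering v,                        *)
(*   +5 leaf label (starting position of the suffix; 0 if internal).    *)

Definition rec_addr (n v : nat) : nat := 16 + n + 6 * v.

Definition suffix_tree_encoding (S : seq nat) (m : nat) (M : nat -> nat) : Prop :=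
  let n := size S in
  let L := suffixes_of S in
  let R := rec_addr n in
  [/\ M 0 = n, M 1 = m,
      (forall i, i < n -> M (16 + i) = nth 0 S i),
      (forall x, (x < 16 /\ x <> 0 /\ x <> 1) \/ 16 + n + 6 * m <= x -> M x = 0)
    & exists (lab : nat -> seq nat) (ch : nat -> seq nat),
      [/\
          [/\ lab 0 = [::],
           (forall v, v < m -> ctrie_node L (lab v)),
           (forall x, ctrie_node L x -> exists2 v, v < m & lab v = x)
         & (forall u v, u < m -> v < m -> lab u = lab v -> u = v)],
          M (R 0) = 0 /\
          (forall v, 0 < v < m -> M (R v) < m /\ ctrie_parent L (lab (M (R v))) (lab v)),
          M (R 0 + 2) = 0 /\
          (forall v, v < m ->
             [/\ uniq (ch v),
                 (forall u, u \in ch v <-> (0 < u < m /\ M (R u) = v)),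
                 M (R v + 1) = head 0 (ch v)
               & forall k, k < size (ch v) ->
                   M (R (nth 0 (ch v) k) + 2) = nth 0 (ch v) k.+1]),
          M (R 0 + 3) = 0 /\ M (R 0 + 4) = 0 /\
          (forall v, 0 < v < m ->
             let st := M (R v + 3) in let len := M (R v + 4) in
             let pl := lab (M (R v)) in
             [/\ 1 <= st, st + len <= n.+1,
                 len = size (lab v) - size pl
               & take len (drop st.-1 S) = drop (size pl) (lab v)])
        &
          (forall v, v < m ->
             if lab v \in L then
               1 <= M (R v + 5) <= n /\ suffix_at S (M (R v + 5)) = lab v
             else M (R v + 5) = 0)]].

(* Output: the position heap, nodes identified by their labels 0..n.   *)
(* With B = M[3], for each node i in 1..n:                             *)
(*   M[B+3i]   = label of the parent of node i,                         *)
(*   M[B+3i+1] = character labelling the edge entering node i,          *)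
(*   M[B+3i+2] = label of the target of the maximal-reach pointer of i. *)

Definition heap_output (S : seq nat) (M : nat -> nat) : Prop :=
  let n := size S in
  let B := M 3 in
  forall i, 1 <= i <= n ->
    let p := ph_label S i in
    [/\ M (B + 3 * i) <= n /\ ph_label S (M (B + 3 * i)) = take (size p).-1 p,
        M (B + 3 * i + 1) = last 0 p
      & let j := M (B + 3 * i + 2) in
        [/\ j <= n, prefix (ph_label S j) (suffix_at S i)
          & forall k, k <= n -> prefix (ph_label S k) (suffix_at S i) ->
              size (ph_label S k) <= size (ph_label S j)]].

(* Main.v *)
Require Import Defs.
From mathcomp Require Import all_boot.
From mathcomp Require Import zify.
Set Implicit Arguments. Unset Strict Implicit. Unset Printing Implicit Defensive.

(* The position heap is the digital search tree of the suffixes, so all its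
   nodes lie on edges of the suffix tree, filled from the top; it suffices to
   keep for each edge how many heap nodes it carries and the label of the
   deepest one.  Call a suffix tree node marked when it is the root or its
   parent's path label is in the heap.  Node i is inserted just below the
   deepest heap node on the edge entering the nearest marked ancestor of leaf i;
   when that edge becomes full, its children become marked.  At the end the same
   ancestor gives the maximal-reach pointer.

   Since marking a node marks all its siblings, and only after its parent, the
   nearest marked ancestor of a leaf is the last mark preceding it in preorder.
   Predecessor queries on a growing set of marks take constant time: positions
   are cut into blocks of b = floor(log2 m) bits, searched by masking and a table
   of binary logarithms; nonempty blocks split the m / b blocks into intervals,
   and each split relabels the smaller part, at a total cost of
   (m / b) log(m / b) = O(m), where m <= 2 n is the number of tree nodes. *)

(** * A structured language compiled to the word RAM *)

(** Inserting directly would mean descending the heap along [S[i..n]], which costs the depth of the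
    new node and a search among children by character. Starting from the leaf of [i] and asking for
    an ancestor removes both: characters are copied from [S] to the output but never compared, and
    child lists are only traversed in full, hence the independence of the alphabet. The machine has
    no instruction for the highest set bit. Masks of [b] bits stay below [2 ^ b <= m], so a table
    with [m] entries replaces it, and a word size far above [log m] costs no larger table. Labelling
    intervals of blocks rather than of positions cancels the logarithmic factor of relabelling the
    smaller part. A single marking may be expensive, so only the total can be bounded: marking is
    charged to a potential that is linear in [m] at the start, everything else to constants per node
    or per suffix. The arguments are carried out on a store of registers and arrays over unbounded
    naturals; addresses and arithmetic modulo [2 ^ w] are dealt with once, in the soundness of the
    compilation. *)

Inductive bop := Add | Sub | Mul | Div | Shl | Shr.
Inductive operand := Reg of nat | Cst of nat.
Inductive op :=
| Bin (o : bop) (r a : nat) (b : operand)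
| SetC (r k : nat)
| LdA (k r j : nat) | StA (k j r : nat)
| LdT (f r v : nat) | LdS (r i : nat) | StO (f i r : nat).
Inductive cond := Lt (a b : nat) | Pos (a : nat).
Inductive cmd :=
| Op of op | Seq of cmd & cmd | Skip
| If of cond & cmd & cmd | While of cond & cmd.

Definition code (l : seq op) (c : cmd) : cmd := foldr (fun o c => Seq (Op o) c) c l.

Definition binI (o : bop) (a b c : nat) : instr :=
  match o with
  | Add => IAdd a b c | Sub => ISub a b c | Mul => IMul a b c
  | Div => IDiv a b c | Shl => IShl a b c | Shr => IShr a b c
  end.

(* Cells 4 and 5 are scratch, M[2] is the base of the work arrays, M[3] the
   base of the output, cells 6 to 15 are the registers of the program.
   Entry [j] of work array [k < 16] is M[M[2] + 16 j + k]. *)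
Definition addrA (k j : nat) : seq instr :=
  [:: IConst 4 16; IMul 4 j 4; IAdd 4 4 2; IConst 5 k; IAdd 4 4 5].
Definition addrT (f v : nat) : seq instr :=
  [:: IConst 4 6; IMul 4 v 4; IAdd 4 4 0; IConst 5 (16 + f); IAdd 4 4 5].
Definition addrO (f i : nat) : seq instr :=
  [:: IConst 4 3; IMul 4 i 4; IAdd 4 4 3; IConst 5 f; IAdd 4 4 5].

Definition comp_op (o : op) : seq instr :=
  match o with
  | Bin o r a (Reg b) => [:: binI o r a b]
  | Bin o r a (Cst k) => [:: IConst 5 k; binI o r a 5]
  | SetC r k => [:: IConst r k]
  | LdA k r j => addrA k j ++ [:: ILoad r 4]
  | StA k j r => addrA k j ++ [:: IStore 4 r]
  | LdT f r v => addrT f v ++ [:: ILoad r 4]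
  | LdS r i => [:: IConst 4 16; IAdd 4 4 i; ILoad r 4]
  | StO f i r => addrO f i ++ [:: IStore 4 r]
  end.

Definition comp_cond (c : cond) (t : nat) : seq instr :=
  match c with
  | Lt a b => [:: IJlt a b t]
  | Pos a => [:: IConst 4 0; IJlt 4 a t]
  end.

Definition csize (c : cond) : nat := if c is Lt _ _ then 1 else 2.

Fixpoint comp (o : nat) (c : cmd) : seq instr :=
  match c with
  | Op p => comp_op p
  | Skip => [::]
  | Seq c1 c2 => let l1 := comp o c1 in l1 ++ comp (o + size l1) c2
  | If b c1 c2 =>
      let o2 := o + csize b in
      let l2 := comp o2 c2 in
      let o1 := o2 + (size l2).+1 in
      let l1 := comp o1 c1 in
      comp_cond b o1 ++ l2 ++ IJmp (o1 + size l1) :: l1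
  | While b c1 =>
      let o1 := o + (csize b).+1 in
      let l1 := comp o1 c1 in
      comp_cond b o1 ++ IJmp (o1 + (size l1).+1) :: rcons l1 (IJmp o)
  end.

(** * Semantics of the language and soundness of its compilation *)

Record store := Store { rg : nat -> nat; ar : nat -> nat -> nat; ou : nat -> nat -> nat }.

Definition set2 (A : nat -> nat -> nat) (k j x : nat) : nat -> nat -> nat :=
  fun k' j' => if (k' == k) && (j' == j) then x else A k' j'.
Definition setr s r x := Store (upd (rg s) r x) (ar s) (ou s).
Definition seta s k j x := Store (rg s) (set2 (ar s) k j x) (ou s).
Definition seto s f i x := Store (rg s) (ar s) (set2 (ou s) f i x).

Definition evb (o : bop) (x y : nat) : nat :=
  match o with
  | Add => x + y | Sub => x - y | Mul => x * y
  | Div => x %/ y | Shl => x * 2 ^ y | Shr => x %/ 2 ^ y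
  end.

Lemma iter_add_run w P t1 t2 s : run w P (t1 + t2) s = run w P t2 (run w P t1 s).
Proof. by rewrite /run addnC iterD. Qed.

Lemma runS w P t s : run w P t.+1 s = run w P t (step w P s).
Proof. by rewrite /run iterSr. Qed.

Section Semantics.
Variables (w n m : nat) (str : nat -> nat) (T : nat -> nat -> nat).

(** [evb] works on unbounded naturals; these are the side conditions under which arithmetic modulo
    [2 ^ w] agrees with it. *)
Definition okb (o : bop) (x y : nat) : Prop :=
  match o with
  | Sub => y <= x < 2 ^ w
  | Div | Shr => True
  | _ => evb o x y < 2 ^ w
  end.

Definition ev_operand s (b : operand) : nat :=
  match b with Reg r => rg s r | Cst k => k end.

Definition ev (o : op) (s : store) : store :=
  match o with
  | Bin o r a b => setr s r (evb o (rg s a) (ev_operand s b))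
  | SetC r k => setr s r k
  | LdA k r j => setr s r (ar s k (rg s j))
  | StA k j r => seta s k (rg s j) (rg s r)
  | LdT f r v => setr s r (T f (rg s v))
  | LdS r i => setr s r (str (rg s i))
  | StO f i r => seto s f (rg s i) (rg s r)
  end.

Definition ok_op (o : op) (s : store) : Prop :=
  match o with
  | Bin o r a b => okb o (rg s a) (ev_operand s b)
  | SetC r k => True
  | LdA k r j => rg s j <= (n + m).+1
  | StA k j r => rg s j <= (n + m).+1
  | LdT f r v => rg s v < m
  | LdS r i => rg s i < n
  | StO f i r => rg s i <= n
  end.

Definition ev_cond (c : cond) (s : store) : bool :=
  match c with Lt a b => rg s a < rg s b | Pos a => 0 < rg s a end.

Definition rd (r : nat) : bool := (r < 2) || (6 <= r < 16).
Definition wr (r : nat) : bool := 6 <= r < 16.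

Definition wf_op (o : op) : bool :=
  match o with
  | Bin o r a b => [&& wr r, rd a & match b with Reg b => rd b | Cst k => k <= 16 end]
  | SetC r k => wr r && (k <= 16)
  | LdA k r j => [&& k < 16, wr r & rd j]
  | StA k j r => [&& k < 16, rd r & rd j]
  | LdT f r v => [&& f < 6, wr r & rd v]
  | LdS r i => wr r && rd i
  | StO f i r => [&& f < 3, rd i & rd r]
  end.

Definition wf_cond (c : cond) : bool :=
  match c with Lt a b => rd a && rd b | Pos a => rd a end.

Fixpoint wf (c : cmd) : bool :=
  match c with
  | Op o => wf_op o | Skip => true | Seq c1 c2 => wf c1 && wf c2
  | If b c1 c2 => [&& wf_cond b, wf c1 & wf c2]
  | While b c1 => wf_cond b && wf c1
  end.

(* [wp c Q k s]: run from [s] with a budget of [k] instructions, [c] terminates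
   within the budget and [Q] holds of what is left of it and of the final store.
   Loops terminate because each iteration consumes budget. *)
Fixpoint wp (c : cmd) (Q : nat -> store -> Prop) (k : nat) (s : store) : Prop :=
  match c with
  | Op o => [/\ ok_op o s, 8 <= k & Q (k - 8) (ev o s)]
  | Skip => Q k s
  | Seq c1 c2 => wp c1 (fun k s => wp c2 Q k s) k s
  | If b c1 c2 => 3 <= k /\ if ev_cond b s then wp c1 Q (k - 3) s else wp c2 Q (k - 3) s
  | While b c1 => exists I : nat -> store -> Prop,
      I k s /\ forall k s, I k s ->
        4 <= k /\ if ev_cond b s then wp c1 I (k - 4) s else Q (k - 4) s
  end.

(** The output follows the encoding, with three cells for each label from 0 to [n]. The sixteen work
    arrays come last and interleaved, so one base address serves them all and no array length has to
    be fixed. *)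
Definition outB := 16 + n + 6 * m.
Definition arrB := outB + 3 * n + 3.

(** [rel_ar] speaks of every index [j], as memory is total; [ok_op] bounds the indices that the
    program uses, which keeps the addresses below [2 ^ w]. *)
Record rel (s : store) (M : nat -> nat) : Prop := Rel {
  rel_n : M 0 = n; rel_m : M 1 = m; rel_rn : rg s 0 = n; rel_rm : rg s 1 = m;
  rel_arr : M 2 = arrB; rel_out : M 3 = outB;
  rel_rg : forall r, wr r -> M r = rg s r;
  rel_str : forall i, i < n -> M (16 + i) = str i;
  rel_T : forall f v, f < 6 -> v < m -> M (16 + n + 6 * v + f) = T f v;
  rel_ou : forall f i, f < 3 -> i <= n -> M (outB + 3 * i + f) = ou s f i;
  rel_ar : forall k j, k < 16 -> M (arrB + 16 * j + k) = ar s k j }.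

Lemma rel_rd s M r : rel s M -> rd r -> M r = rg s r.
Proof.
by move=> R; case: r => [|[|r]] H; rewrite ?(rel_n R, rel_m R, rel_rn R, rel_rm R) // (rel_rg R).
Qed.

Lemma rel_scratch s M a x : rel s M -> a \in [:: 4; 5] -> rel s (upd M a x).
Proof.
move=> R Ha; have {}Ha : a = 4 \/ a = 5 by move: Ha; rewrite !inE; lia.
have E b : b < 4 \/ 6 <= b -> upd M a x b = M b by rewrite /upd; case: eqP => //; lia.
case: R => *; split=> // *; rewrite E ?/wr //; unfold arrB, outB, wr in *; solve [auto | lia].
Qed.

Lemma rel_setr s M r x : rel s M -> wr r -> rel (setr s r x) (upd M r x).
Proof.
move=> R Hr; have {}Hr : 6 <= r < 16 by [].
have E A b : b < 6 \/ 16 <= b -> upd A r x b = A b by rewrite /upd; case: eqP => //; lia.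
case: R => *; split=> //= *;
  try (by rewrite /upd; case: eqP; auto); rewrite E //; unfold arrB, outB, wr in *; solve [auto | lia].
Qed.

Lemma rel_seta s M k j x : rel s M -> k < 16 ->
  rel (seta s k j x) (upd M (arrB + 16 * j + k) x).
Proof.
move=> R Hk.
have E b : b < arrB -> upd M (arrB + 16 * j + k) x b = M b by rewrite /upd; case: eqP => //; lia.
have E2 k' j' : k' < 16 -> upd M (arrB + 16 * j + k) x (arrB + 16 * j' + k') =
    if (k' == k) && (j' == j) then x else M (arrB + 16 * j' + k').
  by move=> h; rewrite /upd; case: eqP; case: andP => //; lia.
case: R => *; split=> //= *; try (rewrite E2 // /set2; case: andP => //; auto);
  rewrite E //; unfold arrB, outB, wr in *; solve [auto | lia].
Qed.

Lemma rel_seto s M f i x : rel s M -> f < 3 -> i <= n ->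
  rel (seto s f i x) (upd M (outB + 3 * i + f) x).
Proof.
move=> R Hf Hi.
have E b : b < outB \/ arrB <= b -> upd M (outB + 3 * i + f) x b = M b.
  by rewrite /upd /arrB; case: eqP => //; lia.
have E2 k' j' : k' < 3 -> upd M (outB + 3 * i + f) x (outB + 3 * j' + k') =
    if (k' == f) && (j' == i) then x else M (outB + 3 * j' + k').
  by move=> h; rewrite /upd; case: eqP; case: andP => //; lia.
case: R => *; split=> //= *; try (rewrite E2 // /set2; case: andP => //; auto);
  rewrite E //; unfold arrB, outB, wr in *; solve [auto | lia].
Qed.

Fixpoint code_at (P : seq instr) (o : nat) (l : seq instr) : Prop :=
  if l is i :: l' then nth IHalt P o = i /\ code_at P o.+1 l' else True.

Lemma code_at_cat P o l1 l2 :
  code_at P o (l1 ++ l2) -> code_at P o l1 /\ code_at P (o + size l1) l2.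
Proof.
elim: l1 o => [|i l1 IH] o /=; first by rewrite addn0.
by case=> -> /IH[]; rewrite addSnnS.
Qed.

Lemma code_at_self A l : code_at (A ++ l) (size A) l.
Proof.
elim: l A => [|i l IH] A //=; split; first by rewrite nth_cat ltnn subnn.
by rewrite -cat_rcons -(size_rcons A i); apply: IH.
Qed.

Lemma code_at_whole P : code_at P 0 P.
Proof. exact: (@code_at_self [::] P). Qed.

Lemma size_comp_cond b t : size (comp_cond b t) = csize b.
Proof. by case: b. Qed.

Lemma step_const P o a k M : nth IHalt P o = IConst a k -> k < 2 ^ w ->
  step w P (State o M) = State o.+1 (upd M a k).
Proof. by move=> E h; rewrite /step /= E /= modn_small. Qed.

Lemma step_bin P o b r x y M : nth IHalt P o = binI b r x y -> okb b (M x) (M y) ->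
  step w P (State o M) = State o.+1 (upd M r (evb b (M x) (M y))).
Proof.
case: b => E; rewrite /step /= E /= => h //; try by rewrite modn_small.
(* The machine subtracts by adding [2 ^ w - M y]; since [M y <= M x], the sum exceeds the true
   difference by exactly [2 ^ w]. *)
case/andP: h => h1 h2; rewrite (modn_small (leq_ltn_trans h1 h2)); congr (State _ (upd _ _ _)).
have -> : M x + (2 ^ w - M y) = M x - M y + 2 ^ w by lia.
by rewrite modnDr modn_small //; lia.
Qed.

Lemma addr_sound P o M a j bs q k :
  code_at P o [:: IConst 4 a; IMul 4 j 4; IAdd 4 4 bs; IConst 5 k; IAdd 4 4 5] ->
  j \notin [:: 4; 5] -> bs \notin [:: 4; 5] -> M j = q ->
  a < 2 ^ w -> M bs + a * q + k < 2 ^ w ->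
  exists2 M', run w P 5 (State o M) = State (o + 5) M' &
     M' 4 = M bs + a * q + k /\
     forall (s : store), rel s M -> rel s M'.
Proof.
case=> h1 [h2 [h3 [h4 [h5 _]]]] Hj Hb Eq Ha Hs.
set M1 := upd M 4 a; set M2 := upd M1 4 (M1 j * M1 4).
set M3 := upd M2 4 (M2 4 + M2 bs); set M4 := upd M3 5 k; set M5 := upd M4 4 (M4 4 + M4 5).
have e0 x : x \notin [:: 4; 5] -> M1 x = M x by rewrite !inE /M1 /upd => /norP[/negbTE->].
have e1 x : x \notin [:: 4; 5] -> M2 x = M x.
  by move=> Hx; rewrite -(e0 _ Hx); move: Hx; rewrite !inE /M2 /upd => /norP[/negbTE->].
have V2 : M2 4 = q * a by rewrite /M2 {1}/upd eqxx (e0 _ Hj) Eq.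
have V3 : M3 4 = q * a + M bs by rewrite /M3 {1}/upd eqxx V2 e1.
have V4 : M4 4 = q * a + M bs /\ M4 5 = k by rewrite /M4 /upd /= V3.
exists M5; last first.
  split; first by rewrite /M5 {1}/upd eqxx V4.1 V4.2; lia.
  by move=> s R; do 5 (apply: rel_scratch => //).
rewrite runS (step_const _ h1) // -/M1.
rewrite runS (step_bin (b := Mul) h2); last by rewrite /= (e0 _ Hj) Eq /M1 /upd /=; lia.
rewrite -[upd _ _ _]/M2 runS (step_bin (b := Add) h3); last by rewrite /= V2 e1 //; lia.
rewrite -[upd _ _ _]/M3 runS (step_const _ h4) -/M4; last by lia.
rewrite runS (step_bin (b := Add) h5); last by rewrite /= V4.1 V4.2; lia.
by rewrite addnC.
Qed.

Lemma rd_scr r : rd r -> r \notin [:: 4; 5].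
Proof. by rewrite /rd !inE; lia. Qed.

Hypothesis Hw : arrB + 16 * (n + m + 2) < 2 ^ w.

Lemma wsmall k : k <= 16 -> k < 2 ^ w. Proof. by move: Hw; rewrite /arrB /outB; lia. Qed.

Lemma op_sound P o p s M : code_at P o (comp_op p) -> wf_op p -> rel s M -> ok_op p s ->
  exists2 M', run w P (size (comp_op p)) (State o M) = State (o + size (comp_op p)) M' &
    rel (ev p s) M'.
Proof.
have W16 := wsmall.
case: p => [b r x [y|k]|r k|k r j|k j r|f r v|r i|f i r].
- rewrite /comp_op /ev /ev_operand /ok_op /= => -[h _] /and3P[wr_ rx ry] R ok_.
  rewrite (step_bin h); rewrite (rel_rd R rx) (rel_rd R ry) //.
  by eexists; [rewrite addn1|apply: rel_setr].
- rewrite /comp_op /ev /ev_operand /ok_op => -[h [h' _]] /and3P[wr_ rx ry] R ok_.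
  have R1 := rel_scratch k R (a := 5) isT.
  rewrite runS (step_const _ h) ?W16 // runS (step_bin h') (rel_rd R1 rx) ?{2}/upd //=.
  by eexists; [rewrite addn2|apply: rel_setr].
- move=> -[h _] /andP[wr_ rx] R _; rewrite runS (step_const _ h) ?W16 //.
  by eexists; [rewrite addn1|apply: rel_setr].
- rewrite /comp_op => /code_at_cat[h [h' _]] /and3P[rk wr_ rj] R ok_.
  case: (addr_sound h (rd_scr rj) _ (rel_rd R rj)) => //; [exact: W16| |].
    by rewrite (rel_arr R); move: Hw; rewrite /= in ok_; lia.
  move=> M' E [V R']; rewrite size_cat iter_add_run {}E.
  eexists; first by move: h'; rewrite runS /step /= => ->; rewrite /= -addn1 -addnA.
  rewrite V (rel_arr R) (rel_ar (R' _ R)) //; exact: rel_setr (R' _ R) wr_.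
- rewrite /comp_op => /code_at_cat[h [h' _]] /and3P[rk wr_ rj] R ok_.
  case: (addr_sound h (rd_scr rj) _ (rel_rd R rj)) => //; [exact: W16| |].
    by rewrite (rel_arr R); move: Hw; rewrite /= in ok_; lia.
  move=> M' E [V R']; rewrite size_cat iter_add_run {}E.
  eexists; first by move: h'; rewrite runS /step /= => ->; rewrite /= -addn1 -addnA.
  rewrite V (rel_arr R) (rel_rd (R' _ R) wr_); exact: rel_seta (R' _ R) rk.
- rewrite /comp_op => /code_at_cat[h [h' _]] /and3P[rk wr_ rj] R ok_.
  rewrite /= in ok_.
  case: (addr_sound h (rd_scr rj) _ (rel_rd R rj)) => //; [exact: W16| |].
    by rewrite (rel_n R); move: Hw; rewrite /arrB /outB; lia.
  move=> M' E [V R']; rewrite size_cat iter_add_run {}E.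
  eexists; first by move: h'; rewrite runS /step /= => ->; rewrite /= -addn1 -addnA.
  rewrite V (rel_n R).
  have -> : n + 6 * rg s v + (16 + f) = 16 + n + 6 * rg s v + f by lia.
  rewrite (rel_T (R' _ R)) //; exact: rel_setr (R' _ R) wr_.
- rewrite /comp_op => -[h1 [h2 [h3 _]]] /andP[wr_ ri] R ok_; rewrite /= in ok_.
  have R1 := rel_scratch 16 R (a := 4) isT.
  have E4 x : upd M 4 x 4 = x by [].
  rewrite runS (step_const _ h1) ?W16 // runS (step_bin (b := Add) h2); last first.
    by rewrite /= E4 (rel_rd R1 ri); move: Hw; rewrite /arrB /outB; lia.
  rewrite runS /step /= h3 /= addn3; eexists; first by [].
  rewrite E4 (rel_rd R1 ri).
  have R2 := rel_scratch (16 + rg s i) R1 (a := 4) isT.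
  have -> : upd (upd M 4 16) 4 (16 + rg s i) 4 = 16 + rg s i by [].
  rewrite (rel_str R2) //; exact: rel_setr R2 wr_.
- rewrite /comp_op => /code_at_cat[h [h' _]] /and3P[rk rj wr_] R ok_; rewrite /= in ok_.
  case: (addr_sound h (rd_scr rj) _ (rel_rd R rj)) => //; [exact: W16| |].
    by rewrite (rel_out R); move: Hw; rewrite /arrB; lia.
  move=> M' E [V R']; rewrite size_cat iter_add_run {}E.
  eexists; first by move: h'; rewrite runS /step /= => ->; rewrite /= -addn1 -addnA.
  rewrite V (rel_out R) (rel_rd (R' _ R) wr_); exact: rel_seto (R' _ R) rk ok_.
Qed.

Lemma size_comp_op p : size (comp_op p) <= 8.
Proof. by case: p => // o r a []. Qed.

Lemma cond_sound P o b t s M : code_at P o (comp_cond b t) -> wf_cond b -> rel s M ->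
  exists2 M', run w P (csize b) (State o M) =
     State (if ev_cond b s then t else o + csize b) M' & rel s M'.
Proof.
case: b => [x y|x].
- case=> h _ /andP[rx ry] R; exists M => //=.
  by rewrite /step /= h /= (rel_rd R rx) (rel_rd R ry) addn1.
- case=> h [h' _] rx R; exists (upd M 4 0); last exact: rel_scratch.
  rewrite runS (step_const _ h) ?wsmall // runS /step /= h' /=.
  by rewrite (rel_rd (rel_scratch 0 R (a := 4) isT) rx) {1}/upd /= addn2.
Qed.

Theorem wp_sound P c : wf c -> forall o Q k s M,
  code_at P o (comp o c) -> rel s M -> wp c Q k s ->
  exists t M' s' k', [/\ run w P t (State o M) = State (o + size (comp o c)) M',
    rel s' M', Q k' s' & t + k' <= k].
Proof.
elim: c => [p|c1 IH1 c2 IH2||b c1 IH1 c2 IH2|b c1 IH] /=.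
- move=> wfp o Q k s M C R [ok_ hk HQ].
  have [M' E R'] := op_sound C wfp R ok_.
  exists (size (comp_op p)), M', (ev p s), (k - 8); split=> //.
  by have := size_comp_op p; lia.
- move=> /andP[w1 w2] o Q k s M /code_at_cat[C1 C2] R H.
  have [t1 [M1 [s1 [k1 [E1 R1 H1 L1]]]]] := IH1 w1 _ _ _ _ _ C1 R H.
  have [t2 [M2 [s2 [k2 [E2 R2 H2 L2]]]]] := IH2 w2 _ _ _ _ _ C2 R1 H1.
  exists (t1 + t2), M2, s2, k2; split=> //; last by lia.
  by rewrite iter_add_run E1 E2 size_cat addnA.
- by move=> _ o Q k s M _ R H; exists 0, M, s, k; rewrite addn0.
- move=> /and3P[wb w1 w2] o Q k s M C R [hk H].
  case: (code_at_cat C); rewrite size_comp_cond => Cb /code_at_cat[C2 [Cj C1]].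
  have [M1 E1 R1] := cond_sound Cb wb R.
  rewrite !size_cat size_comp_cond.
  case: ifP H E1 => _ H E1.
    rewrite -addnS in C1.
    have [t2 [M2 [s2 [k2 [E2 R2 H2 L2]]]]] := IH1 w1 _ _ _ _ _ C1 R1 H.
    exists (csize b + t2), M2, s2, k2; split=> //; last by case: (b) L2 => /=; lia.
    by rewrite iter_add_run E1 E2 /=; congr State; lia.
  have [t2 [M2 [s2 [k2 [E2 R2 H2 L2]]]]] := IH2 w2 _ _ _ _ _ C2 R1 H.
  exists (csize b + t2 + 1), M2, s2, k2; split=> //; last by case: (b) L2 => /=; lia.
  by rewrite !iter_add_run E1 E2 /= /step /= Cj /=; congr State; lia.
- move=> /andP[wb w1] o Q k s M C R [I [I0 HI]].
  case: (code_at_cat C); rewrite size_comp_cond => Cb [Cj].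
  rewrite -cats1 -addnS => /code_at_cat[C1 [Ck _]].
  rewrite !size_cat size_comp_cond /= ?size_cat /=.
  (* Induction on the budget, which drops by at least 4 in every turn. *)
  elim/ltn_ind: k s M R I0 {C} => k IHk s M R /HI[hk H].
  have [M1 E1 R1] := cond_sound Cb wb R.
  case: ifP H E1 => _ H E1.
    have [t2 [M2 [s2 [k2 [E2 R2 H2 L2]]]]] := IH w1 _ _ _ _ _ C1 R1 H.
    have kk : k2 < k by lia.
    have [t3 [M3 [s3 [k3 [E3 R3 H3 L3]]]]] := IHk _ kk _ _ R2 H2.
    exists (csize b + t2 + 1 + t3), M3, s3, k3; split=> //; last by case: (b) L2 => /=; lia.
    by rewrite !iter_add_run E1 E2 /= {1}/step /= Ck /= E3.
  exists (csize b + 1), M1, s, (k - 4); split=> //; last by case: (b) => /=; lia.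
  by rewrite iter_add_run E1 /= /step /= Cj /=; congr State; lia.
Qed.

End Semantics.

(* Work arrays: depth-first stack; preorder and its inverse; preorder number of
   each leaf; binary logarithms; bit mask of each block, and the label [aLB] of
   the block interval [aST, aEN) containing it; label and rank on its edge of
   the deepest heap node on the edge entering a suffix tree node. *)
Notation aSTK := 0 (only parsing).
Notation aORD := 1 (only parsing).
Notation aPRE := 2 (only parsing).
Notation aLF := 3 (only parsing).
Notation aLG := 4 (only parsing).
Notation aW := 5 (only parsing).
Notation aLB := 6 (only parsing).
Notation aST := 7 (only parsing).
Notation aEN := 8 (only parsing).
Notation aLAST := 9 (only parsing).
Notation aCNT := 10 (only parsing).

(** Filled by [log x = log (x / 2) + 1]; entry 1 is right from the start because memory is zero. The
    last load puts the block length [log m] into register 15, where it stays. *)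
Definition log_table : cmd :=
  code [:: SetC 6 2; Bin Add 7 1 (Cst 1)]
 (Seq (While (Lt 6 7) (code
   [:: Bin Div 8 6 (Cst 2); LdA aLG 8 8; Bin Add 8 8 (Cst 1); StA aLG 6 8; Bin Add 6 6 (Cst 1)] Skip))
 (code [:: LdA aLG 15 1] Skip)).

Arguments upd M a v x /.
Arguments set2 A k j x / k' j'.

(** * Rules for symbolic execution with a budget *)

Section WP.
Variables (w n m : nat) (str : nat -> nat) (T : nat -> nat -> nat).
Notation wp := (wp w n m str T).

Section Rules.
Variables (c : cmd) (Q : nat -> store -> Prop) (k : nat) (s : store).

(** The computed value enters as a fresh variable with an equation, so the symbolic store does not
    grow with the expressions evaluated; the load rules have the same shape. *)
Lemma wp_bin o r a b : okb w o (rg s a) (ev_operand s b) -> 8 <= k ->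
  (forall x, x = evb o (rg s a) (ev_operand s b) -> wp c Q (k - 8) (setr s r x)) ->
  wp (Seq (Op (Bin o r a b)) c) Q k s.
Proof. by move=> ? ? H; split=> //; apply: H. Qed.

Lemma wp_setc r x : 8 <= k -> wp c Q (k - 8) (setr s r x) -> wp (Seq (Op (SetC r x)) c) Q k s.
Proof. by []. Qed.

Lemma wp_lda a r j : rg s j <= (n + m).+1 -> 8 <= k ->
  (forall x, x = ar s a (rg s j) -> wp c Q (k - 8) (setr s r x)) ->
  wp (Seq (Op (LdA a r j)) c) Q k s.
Proof. by move=> ? ? H; split=> //; apply: H. Qed.

Lemma wp_ldt f r v : rg s v < m -> 8 <= k ->
  (forall x, x = T f (rg s v) -> wp c Q (k - 8) (setr s r x)) ->
  wp (Seq (Op (LdT f r v)) c) Q k s.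
Proof. by move=> ? ? H; split=> //; apply: H. Qed.

Lemma wp_lds r i : rg s i < n -> 8 <= k ->
  (forall x, x = str (rg s i) -> wp c Q (k - 8) (setr s r x)) ->
  wp (Seq (Op (LdS r i)) c) Q k s.
Proof. by move=> ? ? H; split=> //; apply: H. Qed.

Lemma wp_sta a j r : rg s j <= (n + m).+1 -> 8 <= k ->
  wp c Q (k - 8) (seta s a (rg s j) (rg s r)) -> wp (Seq (Op (StA a j r)) c) Q k s.
Proof. by []. Qed.

Lemma wp_sto f i r : rg s i <= n -> 8 <= k ->
  wp c Q (k - 8) (seto s f (rg s i) (rg s r)) -> wp (Seq (Op (StO f i r)) c) Q k s.
Proof. by []. Qed.
End Rules.

Lemma wp_skip (Q : nat -> store -> Prop) k s : Q k s -> wp Skip Q k s.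
Proof. by []. Qed.

Lemma wp_seq c1 c2 Q k s : wp c1 (fun k s => wp c2 Q k s) k s -> wp (Seq c1 c2) Q k s.
Proof. by []. Qed.

Lemma wp_if b c1 c2 c Q k s : 3 <= k ->
  (ev_cond b s -> wp c1 (fun k s => wp c Q k s) (k - 3) s) ->
  (ev_cond b s = false -> wp c2 (fun k s => wp c Q k s) (k - 3) s) ->
  wp (Seq (If b c1 c2) c) Q k s.
Proof. by move=> hk h1 h2; split=> //; case: ifP. Qed.

Lemma wp_while b c c' I Q k s : I k s ->
  (forall k s, I k s ->
     4 <= k /\ if ev_cond b s then wp c I (k - 4) s else wp c' Q (k - 4) s) ->
  wp (Seq (While b c) c') Q k s.
Proof. by move=> I0 HI; exists I. Qed.

End WP.

Ltac side := try (cbn; lia).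
Ltac stp x E :=
  cbn [code foldr];
  first
  [ refine (wp_bin _ _ _); [side | side | intros x E; cbn in E]
  | refine (wp_lda _ _ _); [side | side | intros x E; cbn in E]
  | refine (wp_ldt _ _ _); [side | side | intros x E; cbn in E]
  | refine (wp_lds _ _ _); [side | side | intros x E; cbn in E] ].
Ltac st :=
  cbn [code foldr];
  first [ refine (wp_setc _ _); [side | ]
  | refine (wp_sta _ _ _); [side | side | ]
  | refine (wp_sto _ _ _); [side | side | ] ].

Section LogTable.
Variables (w n m : nat) (str : nat -> nat) (T : nat -> nat -> nat).
Hypothesis Hw : 16 + n + 6 * m + 3 * n + 3 + 16 * (n + m + 2) < 2 ^ w.
Notation wp := (wp w n m str T).

Lemma wp_log_table Q k s :
  rg s 1 = m -> 2 <= m -> ar s aLG 1 = 0 ->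
  60 * m + 99 <= k ->
  (forall s' k', k - (60 * m + 99) <= k' ->
     (forall x, 0 < x <= m -> ar s' aLG x = trunc_log 2 x) ->
     (forall a j, a <> aLG -> ar s' a j = ar s a j) -> ou s' = ou s ->
     rg s' 0 = rg s 0 -> rg s' 1 = m ->
     rg s' 15 = trunc_log 2 m -> Q k' s') ->
  wp log_table Q k s.
Proof.
move=> Em m2 L1 Hk HQ; rewrite /log_table.
st. stp x E.
pose I k' s' := exists x, [/\ 2 <= x <= m.+1, k <= k' + 60 * x,
  rg s' 6 = x & rg s' 7 = m.+1] /\ [/\ rg s' 0 = rg s 0, rg s' 1 = m, ou s' = ou s,
  forall a j, a <> aLG -> ar s' a j = ar s a j & forall y, 0 < y < x -> ar s' aLG y = trunc_log 2 y].
refine (wp_while (I := I) _ _).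
  exists 2; split; first by split=> //=; lia.
  split=> //= y hy; have -> : y = 1 by lia.
  by rewrite L1.
move=> {E x} k' s' [x [[hx hk E6 E7] [E0 E1 Eo Ea EL]]].
split; first by lia.
rewrite [ev_cond _ _]/= E6 E7; case: ifP => hc.
  stp y Ey. stp z Ez.
  have Ez' : z.+1 = trunc_log 2 x.
    have [x2 x3] : 1 < x /\ 0 < x %/ 2 < x by lia.
    by rewrite (trunc_log2S x2) Ez Ey E6 (EL _ x3) divn2.
  have zx : trunc_log 2 x < 2 ^ trunc_log 2 x by exact: ltn_expl.
  have zy : 2 ^ trunc_log 2 x <= x by apply: trunc_logP; lia.
  stp t Et. st. stp u Eu.
  apply: wp_skip; exists x.+1; split; first by split=> //=; lia.
  split=> //= [a j ha|y0 hy0]; first by rewrite (negbTE (introN eqP ha)) Ea.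
  rewrite E6; case: eqP => [->|hne]; first by rewrite Et -Ez' addn1.
  by rewrite EL //; lia.
stp b Eb.
apply: wp_skip; apply: HQ => //=; first lia.
- by move=> y hy; rewrite EL //; lia.
- by rewrite Eb E1 EL //; lia.
Qed.
End LogTable.

(** * Suffixes and the suffix tree *)

Lemma prefix_size_le (x y : seq nat) : prefix x y -> size x <= size y.
Proof. by case/prefixP=> z ->; rewrite size_cat leq_addr. Qed.

Lemma prefix_takeE (x y : seq nat) : prefix x y -> take (size x) y = x.
Proof. by rewrite prefixE => /eqP. Qed.

Lemma prefix_comparable (x y z : seq nat) :
  prefix x z -> prefix y z -> size x <= size y -> prefix x y.
Proof.
move=> /prefix_takeE Ex /prefix_takeE Ey le.
by rewrite prefixE -Ey take_takel // Ex.
Qed.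

Lemma prefix_antisym (x y : seq nat) : prefix x y -> size y <= size x -> x = y.
Proof. by move=> /prefix_takeE Ex le; rewrite -Ex take_oversize. Qed.

Lemma prefix_takeW (k : nat) (x y : seq nat) : prefix x y -> k <= size x -> take k y = take k x.
Proof. by move=> /prefix_takeE Ex le; rewrite -Ex take_takel. Qed.

Section Suffixes.
Variable S : seq nat.
Notation n := (size S).
Notation L := (suffixes_of S).

Lemma size_suffix i : 0 < i -> size (suffix_at S i) = n.+1 - i.
Proof. by case: i => // i _; rewrite /suffix_at size_drop. Qed.

Lemma suffixesP s : reflect (exists2 i, 1 <= i <= n & s = suffix_at S i) (s \in L).
Proof.
apply: (iffP mapP) => -[i Hi ->]; exists i => //; first by move: Hi; rewrite mem_iota; lia.
by rewrite mem_iota; lia.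
Qed.

Lemma suffix_in i : 1 <= i <= n -> suffix_at S i \in L.
Proof. by move=> Hi; apply/suffixesP; exists i. Qed.

Hypothesis HS : end_marked S.

Lemma n_gt0 : 0 < n. Proof. by case/andP: HS. Qed.

(** If [i > j], the end symbol closing [S[i..n]] would also occur inside [S[j..n]] before the last
    position of [S]. *)
Lemma suffix_prefix_eq i j : 1 <= i <= n -> 1 <= j <= n ->
  prefix (suffix_at S i) (suffix_at S j) -> i = j.
Proof.
move=> Hi Hj P.
have Z : i >= j by move: (prefix_size_le P); rewrite !size_suffix; lia.
case: (ltngtP j i) => // [ij|]; last by lia.
have [_ nm] := andP HS.
have lastE : last 0 S = nth 0 (suffix_at S i) (n - i).
  by rewrite /suffix_at nth_drop -nth_last; congr nth; lia.
case/negP: nm; rewrite lastE -(prefix_takeE P) nth_take; last by rewrite size_suffix; lia.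
rewrite /suffix_at nth_drop.
have -> : nth 0 S (j.-1 + (n - i)) = nth 0 (take n.-1 S) (j.-1 + (n - i)) by rewrite nth_take //; lia.
apply: mem_nth; rewrite size_take; move: Hi Hj ij {lastE P}.
by move: (size S) => q Hi Hj ij; case: ifP; lia.
Qed.

Lemma suffix_at_inj i j : 1 <= i <= n -> 1 <= j <= n -> suffix_at S i = suffix_at S j -> i = j.
Proof. by move=> Hi Hj E; apply: suffix_prefix_eq => //; rewrite E prefix_refl. Qed.

End Suffixes.

(** [T f v] is field [f] of the record of node [v]; passing through [T] keeps memory addresses out
    of the tree arguments. *)
Record stree (S : seq nat) (m : nat) (T : nat -> nat -> nat)
    (lab : nat -> seq nat) (ch : nat -> seq nat) : Prop := STree {
  lab0 : lab 0 = [::];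
  lab_node : forall v, v < m -> ctrie_node (suffixes_of S) (lab v);
  lab_surj : forall x, ctrie_node (suffixes_of S) x -> exists2 v, v < m & lab v = x;
  lab_inj : forall u v, u < m -> v < m -> lab u = lab v -> u = v;
  par_lt : forall v, 0 < v < m -> T 0 v < m;
  parP : forall v, 0 < v < m -> ctrie_parent (suffixes_of S) (lab (T 0 v)) (lab v);
  ch_uniq : forall v, v < m -> uniq (ch v);
  chP : forall v u, v < m -> u \in ch v <-> 0 < u < m /\ T 0 u = v;
  ch_head : forall v, v < m -> T 1 v = head 0 (ch v);
  ch_next : forall v k, v < m -> k < size (ch v) -> T 2 (nth 0 (ch v) k) = nth 0 (ch v) k.+1;
  edgeP : forall v, 0 < v < m -> [/\ 1 <= T 3 v, T 3 v + T 4 v <= (size S).+1,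
     T 4 v = size (lab v) - size (lab (T 0 v))
   & take (T 4 v) (drop (T 3 v).-1 S) = drop (size (lab (T 0 v))) (lab v)];
  leafP : forall v, v < m -> if lab v \in suffixes_of S
     then 1 <= T 5 v <= size S /\ suffix_at S (T 5 v) = lab v else T 5 v = 0 }.

Section Tree.
Variables (S : seq nat) (m : nat) (T : nat -> nat -> nat).
Variables (lab : nat -> seq nat) (ch : nat -> seq nat).
Hypothesis HS : end_marked S.
Hypothesis HT : stree S m T lab ch.
Set Default Proof Using "All".
Notation n := (size S).
Notation L := (suffixes_of S).
Notation par := (T 0).

Lemma par_prefix v : 0 < v < m -> prefix (lab (par v)) (lab v).
Proof. by move=> Hv; case: (parP HT Hv) => _ []. Qed.

Lemma par_size v : 0 < v < m -> size (lab (par v)) < size (lab v).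
Proof. by move=> Hv; case: (parP HT Hv) => _ [_ []]. Qed.

Lemma par_max v u : 0 < v < m -> u < m -> prefix (lab u) (lab v) ->
  size (lab u) < size (lab v) -> size (lab u) <= size (lab (par v)).
Proof.
by move=> Hv Hu; case: (parP HT Hv) => _ [_ [_ H]]; apply: H; apply: (lab_node HT).
Qed.

Lemma trie_node v : v < m -> is_trie_prefix L (lab v).
Proof. by move=> Hv; case: (lab_node HT Hv). Qed.

Lemma trie_prefix_sub x y : is_trie_prefix L y -> prefix x y -> is_trie_prefix L x.
Proof. by case=> s Ls P P'; exists s => //; apply: prefix_trans P. Qed.

Lemma node_size v : v < m -> size (lab v) <= n.
Proof.
move=> /trie_node; case=> s /suffixesP[i Hi Es] P.
by have := prefix_size_le P; rewrite Es size_suffix; lia.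
Qed.

Lemma node_cases v : v < m -> v = 0 \/ 0 < size (lab v).
Proof.
move=> Hv; case E: (lab v) => [|a l]; [left|by right].
by apply: (lab_inj HT); rewrite ?(lab0 HT) //; lia.
Qed.

Lemma leaf_ex i : 1 <= i <= n -> exists2 v, v < m & lab v = suffix_at S i.
Proof.
move=> Hi; apply: (lab_surj HT); split; last by right; left; apply: suffix_in.
by exists (suffix_at S i); rewrite ?suffix_in ?prefix_refl.
Qed.

Lemma leaf_label v i : v < m -> 1 <= i <= n -> lab v = suffix_at S i -> T 5 v = i.
Proof.
move=> Hv Hi E; have := leafP HT Hv; rewrite {1}E suffix_in // => -[H1 H2].
by apply: (suffix_at_inj HS) => //; rewrite H2.
Qed.

Lemma leaf_lab v : v < m -> lab v \in L -> 1 <= T 5 v <= n /\ suffix_at S (T 5 v) = lab v.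
Proof. by move=> Hv Lv; have := leafP HT Hv; rewrite Lv. Qed.

Lemma ch_bound v u : v < m -> u \in ch v -> [/\ 0 < u < m & par u = v].
Proof. by move=> Hv /(chP HT _ Hv)[]. Qed.

Lemma nth_child v j : v < m -> j < size (ch v) ->
  0 < nth 0 (ch v) j < m /\ par (nth 0 (ch v) j) = v.
Proof. by move=> Hv Hj; case: (ch_bound Hv (mem_nth 0 Hj)). Qed.

Lemma ch_mem u : 0 < u < m -> u \in ch (par u).
Proof. by move=> Hu; apply/(chP HT); [apply: (par_lt HT)|]. Qed.

(** Climbing from [u] cannot jump over [v], because by [par_max] a parent is the longest proper
    prefix among the nodes; the last node met before [v] is the child sought. *)
Lemma child_toward v u : v < m -> u < m -> prefix (lab v) (lab u) -> v <> u ->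
  exists2 c, c \in ch v & prefix (lab c) (lab u).
Proof.
move=> Hv; elim: {u}(size (lab u)) {-2}u (leqnn (size (lab u))) => [|k IH] u hk Hu P ne.
  case: ne; apply: (lab_inj HT) => //; apply: prefix_antisym => //; lia.
have lt : size (lab v) < size (lab u).
  rewrite ltn_neqAle prefix_size_le // andbT; apply/eqP => E; apply: ne.
  by apply: (lab_inj HT) => //; apply: prefix_antisym; rewrite ?E.
have Hu' : 0 < u < m by rewrite Hu andbT lt0n; apply/eqP => E; move: lt; rewrite E (lab0 HT).
case: (v =P par u) => [->|ne']; first by exists u; rewrite ?prefix_refl ?ch_mem.
have [||//|//|c cv Pc] := IH (par u).
- by have := par_size Hu'; lia.
- exact: (par_lt HT).
- by apply: (prefix_comparable P (par_prefix Hu')); apply: par_max.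
by exists c => //; apply: prefix_trans Pc (par_prefix Hu').
Qed.

Lemma common_prefix (x y : seq nat) : exists g, [/\ prefix g x, prefix g y &
  [\/ g = x, g = y | exists a b, [/\ a <> b, prefix (rcons g a) x & prefix (rcons g b) y]]].
Proof.
elim: x y => [|a x IH] y; first by exists [::]; split; [|exact: prefix0s|constructor 1].
case: y => [|b y]; first by exists [::]; split; [exact: prefix0s| |constructor 2].
case: (a =P b) => [<-|ne]; last first.
  exists [::]; split; [exact: prefix0s|exact: prefix0s|constructor 3].
  by exists a, b; rewrite /= ?eqxx ?prefix0s.
have [g [gx gy H]] := IH y; exists (a :: g); rewrite /= ?eqxx gx gy; split=> //.
case: H => [->|->|[c [d [cd p1 p2]]]]; [by constructor 1|by constructor 2|].
by constructor 3; exists c, d; rewrite /= ?eqxx p1 p2.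
Qed.

(* A trie position lies on only one edge: two edges sharing a nonempty part
   would branch at a compacted node strictly inside an edge. *)
Lemma edge_unique u v z : 0 < u < m -> 0 < v < m ->
  prefix z (lab u) -> prefix z (lab v) ->
  size (lab (par u)) < size z -> size (lab (par v)) < size z -> u = v.
Proof.
wlog le : u v / size (lab u) <= size (lab v).
  move=> W; case: (leqP (size (lab u)) (size (lab v))) => le; first exact: W.
  by move=> *; apply/esym/W => //; lia.
move=> Hu Hv Pu Pv su sv; have um : u < m by lia.
have vm : v < m by lia.
have [g [gu gv H]] := common_prefix (lab u) (lab v).
(* [z] is a common prefix, so [g] reaches at least as far: if the labels branched earlier, [a] and
   [b] would be the same letter of [z]. *)
have gz : size z <= size g.
  case: H => [->|->|[a [b [ab pa pb]]]]; try exact: prefix_size_le.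
  rewrite leqNgt; apply/negP => lt; apply: ab.
  have E1 := prefix_takeE (prefix_comparable pa Pu _).
  have E2 := prefix_takeE (prefix_comparable pb Pv _).
  rewrite !size_rcons in E1 E2; have := E1 lt; rewrite E2 // => /rcons_inj[->] //.
case: H => [Eg|Eg|[a [b [ab pa pb]]]].
- subst g; case: (ltngtP (size (lab u)) (size (lab v))) le => // [lt|E] _.
    by have := leq_trans (leq_ltn_trans (par_max Hv um gv lt) sv) gz; rewrite ltnn.
  by apply: (lab_inj HT) => //; apply: prefix_antisym => //; rewrite E.
- by subst g; apply: (lab_inj HT) => //; apply: esym; apply: prefix_antisym.
have Ng : ctrie_node L g.
  split; first exact: trie_prefix_sub (trie_node um) gu.
  right; right; exists a, b; split=> //.
  by split; [apply: trie_prefix_sub (trie_node um) pa|apply: trie_prefix_sub (trie_node vm) pb].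
have [x xm Ex] := lab_surj HT Ng.
have := par_max Hu xm; rewrite Ex => /(_ gu).
have := prefix_size_le pa; rewrite size_rcons => lt /(_ lt) le2.
by have := leq_trans (leq_ltn_trans le2 su) gz; rewrite ltnn.
Qed.

(** Some leaf lies below this position; the child toward that leaf is strictly longer than [lab v]
    and so covers the letter [c] as well. *)
Lemma below_node v c : v < m -> is_trie_prefix L (rcons (lab v) c) ->
  exists2 u, u \in ch v & prefix (rcons (lab v) c) (lab u).
Proof.
move=> Hv [s /suffixesP[i Hi ->] Ps].
have [u um Eu] := leaf_ex Hi; rewrite -Eu in Ps.
have Pv : prefix (lab v) (lab u) := prefix_trans (prefix_rcons _ _) Ps.
have ne : v <> u.
  by move=> E; have := prefix_size_le Ps; rewrite size_rcons E ltnn.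
have [d dv Pd] := child_toward Hv um Pv ne; exists d => //.
apply: (prefix_comparable Ps Pd); rewrite size_rcons.
by have [Hd pd] := ch_bound Hv dv; have := par_size Hd; rewrite pd.
Qed.

Lemma branching v : v < m -> lab v \notin L -> 0 < v -> 1 < size (ch v).
Proof.
move=> Hv nL v0; have [_ [E|[E|[a [b [ab [Pa Pb]]]]]]] := lab_node HT Hv.
- by case: (node_cases Hv); rewrite ?E // => e; rewrite e in v0.
- by rewrite E in nL.
have [u uv Pu] := below_node Hv Pa; have [u' uv' Pu'] := below_node Hv Pb.
case E : (ch v) uv uv' => [|x [|y s]] //; rewrite !inE => /eqP Eu /eqP Eu'.
case: ab; subst u u'; have P := prefix_comparable Pu Pu'.
have := prefix_takeE (P _); rewrite !size_rcons => /(_ (leqnn _)).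
by rewrite take_oversize ?size_rcons // => /rcons_inj[].
Qed.

Lemma root_lt : 0 < m.
Proof.
have [v vm _] : exists2 v, v < m & lab v = [::]; last by lia.
apply: (lab_surj HT); split; last by left.
by exists (suffix_at S 1); rewrite ?prefix0s // suffix_in //= (n_gt0 HS).
Qed.

Lemma root_not_leaf : lab 0 \notin L.
Proof.
apply/negP => /suffixesP[i Hi]; rewrite (lab0 HT) => /(congr1 size).
by rewrite size_suffix /=; lia.
Qed.

Lemma root_child : 0 < size (ch 0).
Proof.
have Hi : 1 <= 1 <= n by rewrite (n_gt0 HS).
have [v vm Ev] := leaf_ex Hi.
have [||||c] := @child_toward 0 v => //; first exact: root_lt.
- by rewrite (lab0 HT) prefix0s.
- by move=> E; move: root_not_leaf; rewrite E Ev suffix_in.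
by case: (ch 0).
Qed.

Lemma m_gt1 : 1 < m.
Proof.
have := root_child; case E : (ch 0) => [|c s] // _.
by have [] : [/\ 0 < c < m & par c = 0]; [apply: ch_bound; rewrite ?root_lt // E mem_head|lia].
Qed.

(** Double counting: a node other than the root occurs in the child list of its parent only. *)
Lemma sum_children : \sum_(v < m) size (ch v) <= m.-1.
Proof.
have E (v : 'I_m) : size (ch v) = \sum_(u <- iota 1 m.-1 | par u == v) 1.
  rewrite sum1_count -size_filter; apply/perm_size/uniq_perm.
  - exact: (ch_uniq HT).
  - by rewrite filter_uniq // iota_uniq.
  move=> u; rewrite mem_filter mem_iota; apply/idP/idP.
    by move=> /(ch_bound (ltn_ord v))[Hu <-]; rewrite eqxx; lia.
  by move=> /andP[/eqP Eu Hu]; rewrite -Eu; apply: ch_mem; lia.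
rewrite (eq_bigr _ (fun v _ => E v)) (exchange_big_dep xpredT) //=.
rewrite -[X in _ <= X](size_iota 1) -sum1_size; apply: leq_sum => u _.
rewrite sum1_count; case: (ltnP (par u) m) => lt; last first.
  by rewrite (@eq_count _ _ pred0) ?count_pred0 // => v /=; apply/eqP; have := ltn_ord v; lia.
rewrite (@eq_count _ _ (pred1 (Ordinal lt))).
  by rewrite count_uniq_mem ?index_enum_uniq // leq_b1.
by move=> v /=; rewrite eq_sym.
Qed.

Lemma count_leaves : \sum_(v < m) (lab v \in L) <= n.
Proof.
rewrite -[X in _ <= X](size_iota 1) -big_mkcond /= sum1_card cardE.
rewrite -(size_map (fun v : 'I_m => T 5 v)); apply: uniq_leq_size.
  rewrite map_inj_in_uniq ?enum_uniq // => u v; rewrite !mem_enum !unfold_in => Lu Lv E.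
  have [_ Eu] := leaf_lab (ltn_ord u) Lu; have [_ Ev] := leaf_lab (ltn_ord v) Lv.
  by apply/ord_inj/(lab_inj HT) => //; rewrite -Eu -Ev E.
move=> x /mapP[v]; rewrite mem_enum unfold_in => Lv ->.
by have [H _] := leaf_lab (ltn_ord v) Lv; rewrite mem_iota; lia.
Qed.

(** Every node contributes at least 2 when its children, twice its being a leaf, and one extra unit
    for the root are added up; the root needs this unit as it may have a single child. Summing gives
    [2 m <= (m - 1) + 2 n + 1]. *)
Lemma m_le : m <= 2 * n.
Proof.
have H : \sum_(v < m) 2 <= \sum_(v < m) (size (ch v) + ((lab v \in L) + (lab v \in L)) + (v == 0 :> nat)).
  apply: leq_sum => v _; case: (boolP (lab v \in L)) => [|nL]; first lia.
  case: (posnP v) => [E|v0]; last by have := branching (ltn_ord v) nL v0; lia.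
  by have := root_child; rewrite E /=; lia.
move: H; rewrite !big_split sum_nat_const card_ord.
have -> : \sum_(i < m) (i == 0 :> nat) = 1.
  by rewrite (bigD1 (Ordinal root_lt)) //= big1 // => i /negbTE; rewrite -val_eqE /= => ->.
move: (size S) sum_children count_leaves m_gt1 => q /=.
move: (\sum_(v < m) _) (\sum_(v < m) _) => a b; lia.
Qed.
Unset Default Proof Using.
End Tree.

(** * Preorder numbering *)

Lemma flatten_uniq (f : nat -> seq nat) (s : seq nat) :
  uniq s -> {in s, forall x, uniq (f x)} ->
  {in s &, forall x y z, z \in f x -> z \in f y -> x = y} -> uniq (flatten (map f s)).
Proof.
elim: s => //= x s IH /andP[xs us] Hu Hd; rewrite cat_uniq Hu ?mem_head //=.
rewrite IH // => [|y ys|y z ys zs]; last 2 first.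
- by apply: Hu; rewrite inE ys orbT.
- by apply: Hd; rewrite inE ?ys ?zs orbT.
rewrite andbT; apply/hasPn => z /flatten_mapP[y ys zy]; apply/negP => zx.
by move: xs; rewrite (Hd x y _ _ z) ?inE ?eqxx ?ys ?orbT.
Qed.

Section Preorder.
Variables (S : seq nat) (m : nat) (T : nat -> nat -> nat).
Variables (lab : nat -> seq nat) (ch : nat -> seq nat).
Hypothesis HS : end_marked S.
Hypothesis HT : stree S m T lab ch.
Set Default Proof Using "All".
Notation n := (size S).
Notation L := (suffixes_of S).
Notation par := (T 0).

(** [h] is fuel: labels grow strictly along edges, so [n + 1 - size (lab v)] levels suffice below
    [v]. The child list is reversed because the traversal pushes it in order and pops the last child
    first. *)
Fixpoint po (h v : nat) : seq nat :=
  if h is h'.+1 then v :: flatten (map (po h') (rev (ch v))) else [::].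

Definition preorder (v : nat) : seq nat := po (n.+1 - size (lab v)) v.

Lemma child_size v c : v < m -> c \in ch v -> c < m /\ size (lab v) < size (lab c).
Proof.
move=> Hv cv; have [Hc pc] := ch_bound HS HT Hv cv.
by have := par_size HS HT Hc; rewrite pc; lia.
Qed.

Lemma po_fuel h1 h2 v : v < m -> n < h1 + size (lab v) -> n < h2 + size (lab v) ->
  po h1 v = po h2 v.
Proof.
elim: h1 h2 v => [|h1 IH] h2 v Hv; first by have := node_size HS HT Hv; lia.
case: h2 => [|h2] H1 H2; first by have := node_size HS HT Hv; lia.
rewrite /=; congr (_ :: flatten _); apply/eq_in_map => c; rewrite mem_rev => cv.
by have [cm lt] := child_size Hv cv; apply: IH => //; lia.
Qed.

Lemma preorderE v : v < m -> preorder v = v :: flatten (map preorder (rev (ch v))).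
Proof.
move=> Hv; have sv := node_size HS HT Hv.
rewrite {1}/preorder; have -> : n.+1 - size (lab v) = (n - size (lab v)).+1 by lia.
rewrite /=; congr (_ :: flatten _); apply/eq_in_map => c; rewrite mem_rev => cv.
have [cm lt] := child_size Hv cv.
by apply: po_fuel => //; have := node_size HS HT cm; lia.
Qed.

Lemma node_ind (P : nat -> Prop) :
  (forall v, v < m -> {in ch v, forall c, P c} -> P v) -> forall v, v < m -> P v.
Proof.
move=> H v; move: {2}(n - size (lab v)) (leqnn (n - size (lab v))) => k.
elim: k v => [|k IH] v hk Hv; apply: H => // c cv; have [cm lt] := child_size Hv cv;
  have sc := node_size HS HT cm; [lia|apply: IH; lia].
Qed.

Lemma mem_preorder v x : v < m ->
  x \in preorder v <-> x < m /\ prefix (lab v) (lab x).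
Proof.
move=> Hv; move: v Hv x; apply: node_ind => v Hv IH x; rewrite (preorderE Hv) inE; split.
  case/orP=> [/eqP->|/flatten_mapP[c]]; first by rewrite prefix_refl.
  rewrite mem_rev => cv /(IH c cv x)[xm P]; split=> //.
  have [Hc pc] := ch_bound HS HT Hv cv.
  by apply: prefix_trans P; rewrite -{1}pc; apply: (par_prefix HS HT).
case=> xm P; case: (x =P v) => //= ne.
have [c cv Pc] := child_toward HS HT Hv xm P (fun E => ne (esym E)).
by apply/flatten_mapP; exists c; rewrite ?mem_rev //; apply/(IH c cv).
Qed.

Lemma preorder_uniq v : v < m -> uniq (preorder v).
Proof.
move: v; apply: node_ind => v Hv IH; rewrite (preorderE Hv) /=; apply/andP; split.
  apply/negP => /flatten_mapP[c]; rewrite mem_rev => cv.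
  have [cm lt] := child_size Hv cv.
  by move=> /(mem_preorder _ cm)[_ /prefix_size_le]; lia.
apply: flatten_uniq => [|c|c d]; first by rewrite rev_uniq (ch_uniq HT).
  by rewrite mem_rev; apply: IH.
rewrite !mem_rev => cv dv x; have [cm cs] := child_size Hv cv; have [dm ds] := child_size Hv dv.
move=> /(mem_preorder _ cm)[xm Pc] /(mem_preorder _ dm)[_ Pd].
have [Hc pc] := ch_bound HS HT Hv cv; have [Hd pd] := ch_bound HS HT Hv dv.
apply: (edge_unique HS HT Hc Hd (z := take (size (lab v)).+1 (lab x))).
- by rewrite (prefix_takeW Pc) // prefix_take.
- by rewrite (prefix_takeW Pd) // prefix_take.
- by rewrite pc size_takel //; apply: leq_trans (prefix_size_le Pc).
- by rewrite pd size_takel //; apply: leq_trans (prefix_size_le Pc).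
Qed.

Lemma preorder_infix v u : v < m -> u \in preorder v ->
  exists A B, preorder v = A ++ preorder u ++ B.
Proof.
move=> Hv; move: v Hv u; apply: node_ind => v Hv IH u.
rewrite {1}(preorderE Hv) inE => /orP[/eqP->|/flatten_mapP[c]].
  by exists [::], [::]; rewrite cats0.
move=> cr uc; have [A [B E]] : exists A B, preorder c = A ++ preorder u ++ B.
  by apply: IH uc; rewrite -mem_rev.
rewrite (preorderE Hv); move: cr => /splitPr[s1 s2].
rewrite map_cat flatten_cat /= E.
exists (v :: flatten (map preorder s1) ++ A), (B ++ flatten (map preorder s2)).
by rewrite /= -!catA.
Qed.

Definition order : seq nat := preorder 0.
Definition num (v : nat) : nat := index v order.

Lemma order_uniq : uniq order.
Proof. exact/preorder_uniq/(root_lt HS HT). Qed.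

Lemma mem_order v : (v \in order) = (v < m).
Proof.
apply/idP/idP => [/(mem_preorder _ (root_lt HS HT))[] //|Hv].
by apply/(mem_preorder _ (root_lt HS HT)); rewrite (lab0 HT) prefix0s.
Qed.

Lemma size_order : size order = m.
Proof.
rewrite -(size_iota 0 m); apply/perm_size/uniq_perm; rewrite ?order_uniq ?iota_uniq //.
by move=> v; rewrite mem_order mem_iota.
Qed.

Lemma num_lt v : v < m -> num v < m.
Proof. by rewrite -mem_order -index_mem size_order. Qed.

Lemma nth_num v : v < m -> nth 0 order (num v) = v.
Proof. by rewrite -mem_order; apply: nth_index. Qed.

Lemma num_nth p : p < m -> num (nth 0 order p) = p.
Proof. by move=> Hp; rewrite /num index_uniq ?order_uniq ?size_order. Qed.

Lemma order_lt p : p < m -> nth 0 order p < m.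
Proof. by move=> Hp; rewrite -mem_order mem_nth // size_order. Qed.

Lemma num0 : num 0 = 0.
Proof. by rewrite /num /order (preorderE (root_lt HS HT)) /= ?eqxx. Qed.

Lemma num_inj u v : u < m -> v < m -> num u = num v -> u = v.
Proof. by move=> Hu Hv E; rewrite -(nth_num Hu) E nth_num. Qed.

(** A subtree is a contiguous piece of the preorder. Ancestry thus becomes membership in an interval
    of numbers, which is what turns ancestor queries into predecessor queries. *)
Lemma num_subtree u : u < m -> exists z, forall x, x < m ->
  prefix (lab u) (lab x) = (num u <= num x < z).
Proof.
move=> Hu; have Hu' := Hu; rewrite -mem_order in Hu'.
have [A [B E]] := preorder_infix (root_lt HS HT) Hu'.
have EO : order = A ++ preorder u ++ B by [].
exists (size A + size (preorder u)) => x Hx.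
have Un : uniq (A ++ preorder u ++ B) by rewrite -EO order_uniq.
have numE y : y \in preorder u -> num y = size A + index y (preorder u).
  move=> yu; rewrite /num EO index_cat; case: ifP => [yA|_]; last by rewrite index_cat yu.
  move: Un; rewrite cat_uniq => /and3P[_ /hasPn/(_ y)]; rewrite mem_cat yu => /(_ isT).
  by rewrite yA.
have nu : num u = size A.
  by rewrite numE (preorderE Hu) ?mem_head //= ?eqxx addn0.
apply/idP/idP => [P|/andP[h1 h2]].
  have xu : x \in preorder u by apply/(mem_preorder _ Hu).
  by rewrite nu numE // leq_addr ltn_add2l index_mem.
have : x \in preorder u; last by case/(mem_preorder _ Hu).
rewrite -(nth_num Hx) EO nth_cat nth_cat ltnNge -nu h1 /= nu.
have lt : num x - size A < size (preorder u) by lia.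
by rewrite lt mem_nth.
Qed.

Lemma num_prefix_le u x : u < m -> x < m -> prefix (lab u) (lab x) -> num u <= num x.
Proof. by move=> Hu Hx; have [z ->] := num_subtree Hu => // /andP[]. Qed.

Lemma num_interval u x y : u < m -> x < m -> y < m -> prefix (lab u) (lab y) ->
  num u <= num x <= num y -> prefix (lab u) (lab x).
Proof.
move=> Hu Hx Hy; have [z E] := num_subtree Hu; rewrite !E // => H1 H2; lia.
Qed.

Lemma size_flatten_preorder s : all (fun v => v < m) s -> size s <= size (flatten (map preorder s)).
Proof.
elim: s => //= v s IH /andP[Hv /IH]; rewrite size_cat (preorderE Hv) /=; lia.
Qed.

Unset Default Proof Using.
End Preorder.

(** * Depth-first traversal of the suffix tree *)

Definition push_children : cmd :=
  Seq (While (Pos 10) (code [:: StA aSTK 6 10; Bin Add 6 6 (Cst 1); LdT 2 10 10] Skip)) Skip.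

(** An internal node has leaf label 0, so its write to [aLF] goes to entry 0, which belongs to no
    suffix. *)
Definition dfs : cmd :=
  code [:: SetC 6 1; SetC 7 0]
 (Seq (While (Pos 6) (code
   [:: Bin Sub 6 6 (Cst 1); LdA aSTK 8 6; StA aORD 7 8; StA aPRE 8 7;
       LdT 5 9 8; StA aLF 9 7; Bin Add 7 7 (Cst 1); LdT 1 10 8] push_children))
  Skip).

Section DFS.
Variables (S : seq nat) (m : nat) (T : nat -> nat -> nat).
Variables (lab : nat -> seq nat) (ch : nat -> seq nat) (w : nat) (str : nat -> nat).
Hypothesis HS : end_marked S.
Hypothesis HT : stree S m T lab ch.
Notation n := (size S).
Hypothesis Hw : 16 + n + 6 * m + 3 * n + 3 + 16 * (n + m + 2) < 2 ^ w.
Notation wp := (wp w n m str T).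
Notation preorder := (preorder S lab ch).
Notation order := (order S lab ch).
Notation num := (num S lab ch).
Notation L := (suffixes_of S).

Lemma wp_push_children Q k s v st :
  v < m -> rg s 10 = head 0 (ch v) -> rg s 6 = size st -> size st + size (ch v) <= n + m ->
  (forall p, p < size st -> ar s aSTK p = nth 0 st p) ->
  30 * size (ch v) + 4 <= k ->
  (forall s' k', k <= k' + 30 * size (ch v) + 4 ->
    (forall p, p < size (st ++ ch v) -> ar s' aSTK p = nth 0 (st ++ ch v) p) ->
    (forall a j, a <> aSTK -> ar s' a j = ar s a j) -> ou s' = ou s ->
    (forall r, r < 2 \/ r = 7 -> rg s' r = rg s r) -> rg s' 6 = size (st ++ ch v) ->
    Q k' s') ->
  wp push_children Q k s.
Proof.
move=> Hv E10 E6 Hst Ha Hk HQ.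
pose I k' s' := exists j, let st' := st ++ take j (ch v) in
  [/\ j <= size (ch v), k <= k' + 30 * j, rg s' 10 = nth 0 (ch v) j & rg s' 6 = size st'] /\
  [/\ forall p, p < size st' -> ar s' aSTK p = nth 0 st' p,
      forall a j, a <> aSTK -> ar s' a j = ar s a j, ou s' = ou s &
      forall r, r < 2 \/ r = 7 -> rg s' r = rg s r].
refine (wp_while (I := I) _ _).
  by exists 0; rewrite take0 cats0 nth0; split; split=> //; lia.
move=> k' s' [j [[hj hk F10 F6] [Fa Fb Fo Fr]]]; split; first by lia.
rewrite [ev_cond _ _]/= F10; move: F6 Fa; rewrite size_cat size_takel // => F6 Fa.
case: (ltnP j (size (ch v))) => hc; last first.
  (* Past the last child [nth] yields its default 0, which is also the NIL pointer that stops the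
     loop. *)
  rewrite nth_default // ltnn; apply: wp_skip; apply: HQ => //; first lia.
    by move=> p; rewrite size_cat => hp; rewrite Fa; [rewrite take_oversize|lia].
  by rewrite F6 size_cat; lia.
have [/andP[c0 cm] _] := nth_child HS HT Hv hc; rewrite c0.
st. stp u Eu. stp c Ec.
apply: wp_skip; exists j.+1; rewrite /= in Ec Eu.
have E10' : c = nth 0 (ch v) j.+1 by rewrite Ec F10 (ch_next HT).
rewrite /= (take_nth 0) // -rcons_cat size_rcons size_cat size_takel //.
split; first by split=> //; lia.
split=> [p hp|a i ha||r hr] //=; last 1 first.
- by rewrite Fr //; case: eqP => [|_]; [lia|case: eqP; lia].
- rewrite nth_rcons size_cat size_takel //; rewrite F6 F10.
  case: eqP => [->|hne]; first by rewrite ltnn ?eqxx.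
  by rewrite Fa; [case: ifP => //; lia|lia].
- by rewrite (negbTE (introN eqP ha)) Fb.
Qed.

Lemma wp_dfs Q k s :
  ar s aSTK 0 = 0 -> 200 * m + 100 <= k ->
  (forall s' k', k <= k' + 200 * m + 100 ->
    (forall p, p < m -> ar s' aORD p = nth 0 order p) ->
    (forall v, v < m -> ar s' aPRE v = num v) ->
    (forall v, v < m -> lab v \in L -> ar s' aLF (T 5 v) = num v) ->
    (forall a j, 3 < a -> ar s' a j = ar s a j) -> ou s' = ou s ->
    (forall r, r < 2 -> rg s' r = rg s r) -> Q k' s') ->
  wp dfs Q k s.
Proof.
move=> S0 Hk HQ.
have rm := root_lt HS HT; have Uo := order_uniq HS HT; have So := size_order HS HT.
have So' : size (preorder 0) = m by [].
st. st.
(* What is left of the preorder is the concatenation of the stacked subtrees, top first. Time is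
   charged 40 per stacked and 130 per visited node: a pop frees 90 for the visit, and the 40 of a
   pushed child cover its push. *)
pose I k' s' := exists st d, [/\ order = d ++ flatten (map preorder (rev st)),
    all (fun v => v < m) st, k <= k' + 30 + 130 * size d + 40 * size st,
    rg s' 6 = size st & rg s' 7 = size d] /\
  [/\ forall p, p < size st -> ar s' aSTK p = nth 0 st p,
      forall p, p < size d -> ar s' aORD p = nth 0 d p /\ ar s' aPRE (nth 0 d p) = p,
      forall p, p < size d -> lab (nth 0 d p) \in L -> ar s' aLF (T 5 (nth 0 d p)) = p,
      (forall a j, 3 < a -> ar s' a j = ar s a j) /\ ou s' = ou s &
      forall r, r < 2 -> rg s' r = rg s r].
refine (wp_while (I := I) _ _).
  exists [:: 0], [::]; rewrite /= rm; split; first by split=> //; [rewrite cats0|lia].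
  by split=> // [[]|[|[]]] //.
move=> k' s' [st [d [[Eo Ast Ek E6 E7] [Fs Fo Fl [Fa Fu] Fr]]]].
have Sz := size_flatten_preorder HS HT (s := rev st); rewrite all_rev size_rev in Sz.
have {Sz} Sz := Sz Ast.
have Sm : size d + size (flatten (map preorder (rev st))) = m.
  by rewrite -So Eo size_cat.
split; first by lia.
rewrite [ev_cond _ _]/= E6; case: (ltnP 0 (size st)) => [|hc]; last first.
  have E0 : st = [::] by apply/eqP; rewrite -size_eq0 -leqn0.
  have Ed : order = d by rewrite Eo E0 cats0.
  rewrite -Ed So in Fo Fl Ek.
  apply: wp_skip; apply: HQ => //; first by rewrite E0 /= in Ek; lia.
  - by move=> p /Fo[].
  - by move=> v Hv; case: (Fo _ (num_lt HS HT Hv)); rewrite (nth_num HS HT Hv).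
  - by move=> v Hv Lv; have := Fl _ (num_lt HS HT Hv); rewrite (nth_num HS HT Hv); apply.
case/lastP: st Eo Ast Ek E6 Fs Sz Sm => // st v.
rewrite !size_rcons rev_rcons all_rcons => Eo /andP[Hv Ast] Ek E6 Fs Sz Sm _.
have Sv : size (flatten (map preorder (rev (ch v)))) >= size (ch v).
  rewrite -(size_rev (ch v)); apply: (size_flatten_preorder HS HT).
  apply/allP => c; rewrite mem_rev => cv; by case: (child_size HS HT Hv cv).
have Sr : size (flatten (map preorder (rev st))) >= size st.
  by rewrite -(size_rev st); apply: (size_flatten_preorder HS HT); rewrite all_rev.
have E : size (flatten (map preorder (v :: rev st))) =
    (size (flatten (map preorder (rev (ch v))))).+1 + size (flatten (map preorder (rev st))).
  by rewrite [flatten _]/= size_cat (preorderE HS HT Hv).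
(* Stacked subtrees are nonempty disjoint parts of the preorder, so the stack together with the new
   children stays within its work array. *)
rewrite E in Sm; have {E}Sm : size d + size (ch v) + size st < m by lia.
have {Sv Sr Sz} Sr : size st <= m by lia.
have T5 : T 5 v <= n.
  by have := leafP HT Hv; case: ifP => _ => [[/andP[]]|->].
stp a Ea. stp v' Ev. rewrite /= in Ev.
have Ev' : v' = v by rewrite Ev Ea E6 subn1 Fs // nth_rcons ltnn eqxx.
move: Ev' {Ev} => ?; subst v'.
st. st. stp x Ex. st. stp y Ey. stp c Ec. rewrite /= in Ex Ey Ec.
have [dm vd] : {in d, forall u, u < m} /\ v \notin d.
  split=> [u ud|]; first by rewrite -(mem_order HS HT) Eo mem_cat ud.
  apply/negP => vd; move: Uo; rewrite Eo cat_uniq => /and3P[_ /hasPn/(_ v) H _].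
  by move: H; rewrite [flatten _]/= (preorderE HS HT Hv) mem_head vd => /(_ isT).
(* Writing the entry of [v] cannot overwrite that of a leaf visited before: [v] is new, and an
   internal node writes to entry 0. *)
have Tne p : p < size d -> lab (nth 0 d p) \in L -> T 5 (nth 0 d p) == x = false.
  move=> hp Lp; apply/eqP => E; have ud := mem_nth 0 hp; have um := dm _ ud.
  have [T1 Elab] := leaf_lab HS HT um Lp.
  have := leafP HT Hv; rewrite -Ex -E Elab; case: ifP => _; last by move=> E0; rewrite E0 in T1.
  by move=> [_ /(lab_inj HT um Hv) Euv]; move: vd; rewrite -Euv ud.
apply: (wp_push_children (v := v) (st := st)) => //=.
- by rewrite Ec (ch_head HT).
- by lia.
- by lia.
- by move=> p hp; rewrite Fs ?nth_rcons ?hp //; lia.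
- by lia.
move=> s2 k2 Ek2 Gs Ga Gu Gr G6.
exists (st ++ ch v), (rcons d v); split; first split.
- rewrite Eo [in LHS]/= (preorderE HS HT Hv) rev_cat map_cat flatten_cat -cats1 -!catA //.
- rewrite all_cat Ast; apply/allP => c' cv; by case: (child_size HS HT Hv cv).
- by rewrite size_cat size_rcons; lia.
- by [].
- by rewrite Gr ?size_rcons /=; lia.
split=> //.
- move=> p; rewrite size_rcons => hp; rewrite !Ga //= nth_rcons E7.
  case: (ltngtP p (size d)) => hc; last 1 first.
  + by rewrite hc !eqxx.
  + have [Fo1 Fo2] := Fo _ hc; split=> //.
    by case: eqP => // E; move: vd; rewrite -E mem_nth.
  + by lia.
- move=> p; rewrite size_rcons => hp; rewrite !Ga //= nth_rcons E7.
  case: (ltngtP p (size d)) => hc; last 1 first.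
  + by rewrite hc -Ex eqxx.
  + by move=> Lp; rewrite Tne // Fl.
  + by lia.
- split; last by rewrite Gu.
  move=> a' j ha; rewrite Ga; last by lia.
  by case: a' ha => [|[|[|[|a']]]] //= ha; rewrite Fa.
- by move=> r hr; rewrite Gr; [case: r hr => [|[|r]] //= hr; rewrite Fr|left].
Qed.

End DFS.

(** * Predecessor structure: bit blocks and block-level splitting *)

Fixpoint bits (k : nat) (f : nat -> bool) : nat :=
  if k is k'.+1 then bits k' f + f k' * 2 ^ k' else 0.

Lemma bits_lt k f : bits k f < 2 ^ k.
Proof. by elim: k => //= k IH; rewrite expnS; case: (f k); lia. Qed.

Lemma eq_bits k f g : (forall a, a < k -> f a = g a) -> bits k f = bits k g.
Proof. by elim: k => //= k IH E; rewrite IH ?E // => a ak; apply: E; lia. Qed.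

Lemma bits_split k l f : bits (k + l) f = bits k f + 2 ^ k * bits l (fun a => f (k + a)).
Proof. by elim: l => [|l IH]; rewrite ?addn0 ?addnS /= ?muln0 ?addn0 // IH expnD; lia. Qed.

(** Shifting right and back clears the low [k] bits, so the difference is those bits alone. *)
Lemma bits_low k b f : k <= b -> bits b f - bits b f %/ 2 ^ k * 2 ^ k = bits k f.
Proof.
move=> kb; have E2 : 2 ^ k > 0 by rewrite expn_gt0.
have := bits_split k (b - k) f; rewrite subnKC // => ->.
rewrite mulnC addnC divnMDl // divn_small ?bits_lt // addn0; lia.
Qed.

Lemma bits_eq0 k (f : nat -> bool) a : bits k f = 0 -> a < k -> f a = false.
Proof.
elim: k => //= k IH E; rewrite ltnS leq_eqVlt => /orP[/eqP->|].
  have E2 : 0 < 2 ^ k by rewrite expn_gt0.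
  by case: (f k) E => //; lia.
by apply: IH; lia.
Qed.

Lemma bits_pos k (f : nat -> bool) a : a < k -> f a -> 0 < bits k f.
Proof. by move=> ak fa; rewrite lt0n; apply/eqP => /bits_eq0/(_ ak); rewrite fa. Qed.

(** The binary logarithm of a mask is its highest set bit; one table lookup therefore finds the last
    mark of a block. *)
Lemma bits_msb k f : 0 < bits k f ->
  let t := trunc_log 2 (bits k f) in [/\ t < k, f t & forall a, t < a < k -> f a = false].
Proof.
elim: k => //= k IH; case E: (f k) => /=.
  have h := bits_lt k f; rewrite mul1n => _.
  have -> : trunc_log 2 (bits k f + 2 ^ k) = k.
    by apply: trunc_log_eq => //; rewrite expnS; lia.
  by split=> // a; lia.
rewrite mul0n addn0 => /IH[h1 h2 h3]; split=> // [|a]; first lia.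
by move=> h; case: (ltngtP a k) => hc; [apply: h3; lia|lia|rewrite hc].
Qed.

Lemma bits_set b f x : x < b -> f x = false ->
  bits b f + 2 ^ x = bits b (fun a => f a || (a == x)).
Proof.
elim: b => //= b IH; rewrite ltnS leq_eqVlt => /orP[/eqP->|xb] fx.
  rewrite fx eqxx /= addn0 mul1n; congr (_ + _); apply: eq_bits => a ab.
  by rewrite (ltn_eqF ab) orbF.
by rewrite -IH // (gtn_eqF xb) orbF; lia.
Qed.

(* Splitting off the smaller part of an interval is paid for by the decrease
   of the sum of [nlogn] over the interval lengths. *)
Definition nlogn (s : nat) : nat := s * trunc_log 2 s.

(** By [2 a <= a + b] the logarithm of the whole exceeds that of the smaller part by at least one,
    which yields the additional [a]. *)
Lemma nlogn_split a b : 0 < a <= b -> nlogn a + nlogn b + a <= nlogn (a + b).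
Proof.
move=> /andP[a0 ab]; rewrite /nlogn.
have la : (trunc_log 2 a).+1 <= trunc_log 2 (a + b).
  apply: leq_trans (leq_trunc_log 2 (_ : a.*2 <= _)); last by lia.
  by rewrite trunc_log2_double.
have lb : trunc_log 2 b <= trunc_log 2 (a + b) by apply: leq_trunc_log; lia.
rewrite mulnDl; have := leq_mul (leqnn a) la; have := leq_mul (leqnn b) lb; lia.
Qed.

Definition relabel : cmd :=
  While (Lt 12 13) (code [:: StA aLB 12 10; Bin Add 12 12 (Cst 1)] Skip).

(** Interval labels are numbers of nonempty blocks. The block in register 10 was empty until now, so
    its number is a fresh label; it goes to the shorter side. Adding 0 copies a register. *)
Definition split_block : cmd := code
  [:: LdA aLB 11 10; LdA aST 12 11; LdA aEN 13 11;
      Bin Sub 14 10 (Reg 12); Bin Sub 9 13 (Reg 10)]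
 (Seq (If (Lt 9 14)
    (code [:: StA aST 10 10; StA aEN 10 13; StA aEN 11 10; Bin Add 12 10 (Cst 0)] Skip)
    (code [:: StA aST 10 12; StA aEN 10 10; StA aST 11 10; Bin Add 13 10 (Cst 0)] Skip))
 (Seq relabel Skip)).

(* Marks the position in register 9; register 15 holds the block length. *)
Definition mark : cmd := code
  [:: Bin Div 10 9 (Reg 15); Bin Mul 11 10 (Reg 15); Bin Sub 11 9 (Reg 11);
      SetC 12 1; Bin Shl 12 12 (Reg 11); LdA aW 13 10; Bin Add 12 12 (Reg 13); StA aW 10 12]
 (If (Pos 13) Skip split_block).

(* Sets register 7 to the node at the last mark up to the position in register 8. *)
Definition find_pred : cmd := code
  [:: Bin Div 9 8 (Reg 15); Bin Mul 10 9 (Reg 15); Bin Sub 10 8 (Reg 10); Bin Add 10 10 (Cst 1);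
      LdA aW 11 9; Bin Shr 12 11 (Reg 10); Bin Shl 12 12 (Reg 10); Bin Sub 11 11 (Reg 12)]
 (Seq (If (Pos 11) Skip
    (code [:: Bin Sub 9 9 (Cst 1); LdA aLB 12 9; LdA aST 9 12; LdA aW 11 9] Skip))
 (code [:: LdA aLG 12 11; Bin Mul 9 9 (Reg 15); Bin Add 9 9 (Reg 12); LdA aORD 7 9] Skip)).

(** * Correctness and amortized cost of the predecessor structure *)

Section Blocks.
Variables (w n m : nat) (str : nat -> nat) (T : nat -> nat -> nat) (b : nat).
Hypothesis Hw : 16 + n + 6 * m + 3 * n + 3 + 16 * (n + m + 2) < 2 ^ w.
Hypothesis b0 : 0 < b.
Hypothesis bm : 2 ^ b <= m.
Notation wp := (wp w n m str T).

Definition nb := (m %/ b).+1.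

(** An interval consists of a nonempty block and the empty blocks after it. Its label is a nonempty
    block that need not lie in the interval: only the shorter side of a split is relabelled, so the
    label cannot follow the start. *)
Record blocks (mk : nat -> bool) (s : store) : Prop := Blocks {
  bl_b : rg s 15 = b;
  bl_log : forall x, 0 < x <= m -> ar s aLG x = trunc_log 2 x;
  bl_mk0 : mk 0;
  bl_mk : forall p, mk p -> p < m;
  bl_W : forall j, j < nb -> ar s aW j = bits b (fun a => mk (j * b + a));
  bl_LB : forall j, j < nb -> let i := ar s aLB j in
    [/\ i < nb, ar s aST i <= j < ar s aEN i, ar s aEN i <= nb, 0 < ar s aW i
      & 0 < ar s aW (ar s aST i)];
  bl_in : forall j j', j < nb -> ar s aST (ar s aLB j) <= j' < ar s aEN (ar s aLB j) ->
    ar s aLB j' = ar s aLB j;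
  bl_empty : forall j j', j < nb -> ar s aST (ar s aLB j) < j' < ar s aEN (ar s aLB j) ->
    ar s aW j' = 0 }.

Definition unmarked (mk : nat -> bool) : nat := count (fun p => ~~ mk p) (iota 0 m).

Definition weight (s : store) (i : nat) : nat :=
  if 0 < ar s aW i then nlogn (ar s aEN i - ar s aST i) else 0.

(** Relabelling one block costs 20, paid by the drop of the [nlogn] sum. Each newly marked position
    frees 400 for the constant work around it. Only numbers of nonempty blocks serve as labels,
    hence the test in [weight]. *)
Definition potential (mk : nat -> bool) (s : store) : nat :=
  20 * \sum_(i < nb) weight s i + 400 * unmarked mk.

Lemma nb_le : nb <= m.+1.
Proof. by rewrite /nb ltnS leq_div. Qed.

Lemma block_lt p : p < m -> p %/ b < nb.
Proof. by move=> pm; rewrite /nb ltnS; apply: leq_div2r; apply: ltnW. Qed.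

Lemma block_W mk s j : blocks mk s -> j < nb -> ar s aW j < 2 ^ b.
Proof. by move=> B Hj; rewrite (bl_W B Hj) bits_lt. Qed.

Lemma block_mk mk s p : blocks mk s -> mk p -> 0 < ar s aW (p %/ b).
Proof.
move=> B Hp; rewrite (bl_W B) ?block_lt ?(bl_mk B) //.
by apply: (bits_pos (ltn_pmod p b0)); rewrite -divn_eq.
Qed.

Lemma top_in_block mk j x (r := j * b + trunc_log 2 (bits x (fun a => mk (j * b + a)))) :
  x <= b -> 0 < bits x (fun a => mk (j * b + a)) ->
  [/\ mk r, r < j * b + x & forall p, mk p -> p < j * b + x -> p <= r].
Proof.
move=> xb /bits_msb[]; rewrite -/r => h1 h2 h3; split=> //; first by rewrite ltn_add2l.
move=> p Hp lt; rewrite leqNgt; apply/negP => rp.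
have E : p = j * b + (p - j * b) by move: rp; rewrite /r; lia.
have := h3 (p - j * b); rewrite -E Hp => H.
have : true = false by apply: H; move: rp lt; rewrite /r; lia.
by [].
Qed.

Lemma wp_find_pred mk Q k s :
  blocks mk s -> rg s 8 < m -> 200 <= k ->
  (forall p s' k', k <= k' + 200 -> mk p -> p <= rg s 8 ->
    (forall p', mk p' -> p' <= rg s 8 -> p' <= p) ->
    rg s' 7 = ar s aORD p -> (forall r, r < 7 \/ r = 15 -> rg s' r = rg s r) ->
    ar s' = ar s -> ou s' = ou s -> Q k' s') ->
  wp find_pred Q k s.
Proof.
move=> B Hq Hk HQ; have Nb := nb_le; have Eb := bl_b B.
set q := rg s 8 in Hq HQ *.
have [j [r [Ej hm hx hj hd2]]] : exists j r, [/\ j = q %/ b, q = j * b + r, r < b, j < nb & j <= q].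
  exists (q %/ b), (q %% b); split=> //; [exact: divn_eq|by rewrite ltn_pmod|exact: block_lt|exact: leq_div].
have hb : b < 2 ^ b := ltn_expl b (isT : 1 < 2).
have hW := block_W B hj.
set f := fun a => mk (j * b + a).
have EW : ar s aW j = bits b f by rewrite (bl_W B).
have Elow : bits b f - bits b f %/ 2 ^ r.+1 * 2 ^ r.+1 = bits r.+1 f by apply: bits_low.
have hdW := leq_divM (bits b f) (2 ^ r.+1).
stp x Ex; rewrite /= -/q Eb -Ej in Ex; subst x.
stp x Ex; rewrite /= Eb in Ex; subst x.
stp x Ex; rewrite /= -/q in Ex; have {}Ex : x = r by lia.
rewrite {}Ex; stp y Ey; rewrite addn1 in Ey; subst y.
stp W EW'; rewrite EW in EW'; subst W.
stp y Ey; rewrite /= in Ey; subst y.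
stp y Ey; rewrite /= in Ey; subst y.
stp y Ey; rewrite /= Elow in Ey; subst y.
have tail j2 x2 k2 s2 : rg s2 9 = j2 -> rg s2 11 = bits x2 (fun a => mk (j2 * b + a)) ->
    0 < rg s2 11 -> x2 <= b -> j2 * b + x2 <= q.+1 ->
    (forall p, mk p -> p <= q -> p < j2 * b + x2) ->
    (forall a, a < 7 \/ a = 15 -> rg s2 a = rg s a) -> ar s2 = ar s -> ou s2 = ou s ->
    100 <= k2 -> k <= k2 + 150 ->
    wp (code [:: LdA aLG 12 11; Bin Mul 9 9 (Reg 15); Bin Add 9 9 (Reg 12); LdA aORD 7 9] Skip) Q k2 s2.
  move=> F9 F11 Fpos Fx Fq Fp Fr Fa Fo Hk2 Hk3.
  have [T1 T2 T3] : [/\ _, _ & _] := top_in_block Fx (eq_ind _ (fun z => 0 < z) Fpos _ F11).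
  have lt11 : rg s2 11 <= m.
    rewrite F11; apply: leq_trans (ltnW (bits_lt _ _)) _; apply: leq_trans bm; exact: leq_pexp2l.
  have pm := bl_mk B T1.
  have EL : ar s2 aLG (rg s2 11) = trunc_log 2 (rg s2 11) by rewrite Fa (bl_log B) // Fpos.
  have E15 : rg s2 15 = b by rewrite Fr ?Eb //; right.
  rewrite -F11 in T1 T2 T3 pm.
  stp t Et; rewrite /= EL in Et.
  stp y Ey.
  rewrite /= F9 E15 in Ey.
  stp z Ez; rewrite /= in Ez.
  have {}Ez : z = j2 * b + trunc_log 2 (rg s2 11) by rewrite Ez Ey Et.
  rewrite -Ez in T1 T2 T3 pm.
  stp u Eu; rewrite /= in Eu.
  apply: wp_skip; apply: (HQ z) => //.
  - by lia.
  - by lia.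
  - by move=> p' Hp Hpq; apply: T3 => //; apply: Fp.
  - by rewrite /= Eu Fa.
  - by move=> a [ha|->] /=; [case: a ha => [|[|[|[|[|[|[|a]]]]]]] //= _; apply: Fr; left|apply: Fr; right].
apply: wp_if; first by lia.
  move=> C; apply: wp_skip; apply: (tail j r.+1) => //=; try lia.
  by move=> a [ha|->] //=; case: a ha => [|[|[|[|[|[|[|a]]]]]]].
move=> C; have {}C : bits r.+1 f = 0 by apply/eqP; rewrite -leqn0 leqNgt; apply/negbT/C.
have nf a : a < r.+1 -> mk (j * b + a) = false := bits_eq0 C.
(* The position of the root is always marked, so an earlier block exists. *)
have j0 : 0 < j.
  rewrite lt0n; apply/eqP => E; have := nf 0 isT.
  by rewrite E mul0n (bl_mk0 B).
(* The lookup is at [j - 1], not [j]: block [j] may hold marks beyond [q] and then starts an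
   interval itself, whereas the interval of [j - 1] starts at the last nonempty block before [j]. *)
have hj1 : j - 1 < nb by lia.
have [L1 /andP[L2 L2'] L3 L4 L5] := bl_LB B hj1.
have LE := bl_empty B hj1.
stp y Ey; rewrite /= in Ey; subst y.
stp i Ei; rewrite /= in Ei; rewrite -Ei in L1 L2 L2' L3 L4 L5 LE.
stp i2 Est; rewrite /= in Est; rewrite -Est in L2 L5 LE.
stp W EW'; rewrite /= in EW'; rewrite -EW' in L5.
have hst : i2 < nb by lia.
apply: wp_skip; apply: (tail i2 b) => //=; try lia.
- by rewrite EW' (bl_W B).
- rewrite hm; have := leq_mul (_ : i2.+1 <= j) (leqnn b); rewrite mulSn; lia.
- move=> p Hp Hpq; have hp := divn_eq p b; have hpb : p %% b < b by rewrite ltn_pmod.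
  have Wp := block_mk B Hp.
  suff : p %/ b <= i2 by move/leq_mul => /(_ _ _ (leqnn b)); lia.
  rewrite leqNgt; apply/negP => lt.
  have le : p %/ b <= j by rewrite Ej; apply: leq_div2r.
  case: (ltngtP (p %/ b) j) le => // [lt2|E] _.
    by move: Wp; rewrite (LE (p %/ b)) //; lia.
  by have := nf (p %% b); rewrite -E -hp Hp => H; have : true = false by apply: H; rewrite -E in hm; lia.
- by move=> a [ha|->] //=; case: a ha => [|[|[|[|[|[|[|a]]]]]]].
Qed.

Lemma wp_relabel c Q k s lo hi j :
  rg s 12 = lo -> rg s 13 = hi -> rg s 10 = j -> lo <= hi <= nb ->
  20 * (hi - lo) + 4 <= k ->
  (forall s' k', k <= k' + (20 * (hi - lo) + 4) ->
    (forall x, ar s' aLB x = if lo <= x < hi then j else ar s aLB x) ->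
    (forall a x, a <> aLB -> ar s' a x = ar s a x) -> ou s' = ou s ->
    (forall r, r <> 12 -> rg s' r = rg s r) -> wp c Q k' s') ->
  wp (Seq relabel c) Q k s.
Proof.
move=> E12 E13 E10 Hlo Hk HQ; have Nb := nb_le.
pose I k' s' := exists x, [/\ lo <= x <= hi, k <= k' + 20 * (x - lo) & rg s' 12 = x] /\
  [/\ forall y, ar s' aLB y = if lo <= y < x then j else ar s aLB y,
     forall a x, a <> aLB -> ar s' a x = ar s a x, ou s' = ou s &
     forall r, r <> 12 -> rg s' r = rg s r].
refine (wp_while (I := I) _ _).
  exists lo; split; first by split=> //; lia.
  by split=> // y; case: ifP => //; lia.
move=> k' s' [x [[Hx Ek F12] [FL Fa Fo Fr]]]; split; first by lia.
rewrite [ev_cond _ _]/= F12 Fr // E13; case: ifP => C; last first.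
  have Exh : x = hi by lia.
  by apply: HQ => //; [lia|rewrite -Exh].
st. stp y Ey; rewrite /= in Ey.
apply: wp_skip; exists x.+1; split; first by split=> //=; lia.
split=> //= [y'|a y' ha|r hr].
- rewrite F12 Fr // E10 FL; case: eqP => [->|ne]; first by rewrite ifT //; lia.
  by have -> : lo <= y' < x.+1 = (lo <= y' < x) by lia.
- by rewrite (negbTE (introN eqP ha)) Fa.
- by rewrite (negbTE (introN eqP hr)) Fr.
Qed.

(* The effect of splitting at [j] the block interval [c, e) with label [id]:
   [j] becomes the label of [l1, h1), [id] keeps [l2, h2). *)
Lemma split_blocks (mk mk' : nat -> bool) s s' j id c e l1 h1 l2 h2 :
  blocks mk s -> j < nb -> ar s aW j = 0 ->
  id = ar s aLB j -> c = ar s aST id -> e = ar s aEN id ->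
  (l1, h1, l2, h2) = (j, e, c, j) \/ (l1, h1, l2, h2) = (c, j, j, e) ->
  (forall x, ar s' aLB x = if l1 <= x < h1 then j else ar s aLB x) ->
  ar s' aST j = l1 -> ar s' aEN j = h1 -> ar s' aST id = l2 -> ar s' aEN id = h2 ->
  (forall i, i <> j -> i <> id -> ar s' aST i = ar s aST i /\ ar s' aEN i = ar s aEN i) ->
  (forall i, i <> j -> ar s' aW i = ar s aW i) -> 0 < ar s' aW j ->
  rg s' 15 = b -> (forall x, ar s' aLG x = ar s aLG x) ->
  mk' 0 -> (forall p, mk' p -> p < m) ->
  (forall i, i < nb -> ar s' aW i = bits b (fun a => mk' (i * b + a))) ->
  [/\ blocks mk' s', c < j < e, e <= nb &
    \sum_(i < nb) weight s' i + minn (j - c) (e - j) <= \sum_(i < nb) weight s i].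
Proof.
move=> B Hj W0 Eid Ec Ee Hcase FL Sj Ej Si Ei Fo FW Wj E15 EG M0 Mm MW.
have [L1 /andP[L2 L2'] L3 L4 L5] := bl_LB B Hj.
rewrite -Eid -Ec -Ee in L1 L2 L2' L3 L4 L5.
have cj : c < j by rewrite ltn_neqAle L2 andbT; apply/eqP => E; rewrite E W0 in L5.
have idj : id <> j by move=> E; rewrite E W0 in L4.
have inj x : c <= x < e -> ar s aLB x = id by rewrite Ec Ee Eid; apply: (bl_in B Hj).
have emp x : c < x < e -> ar s aW x = 0 by rewrite Ec Ee Eid; apply: (bl_empty B Hj).
have [H12 H1 H2] : [/\ forall x, (l1 <= x < h1) || (l2 <= x < h2) = (c <= x < e),
    forall x, l1 <= x < h1 -> l2 <= x < h2 -> False &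
    (l1 = c \/ l1 = j) /\ (l2 = c \/ l2 = j)].
  by case: Hcase => -[-> -> -> ->]; split; [lia|lia|lia|lia|lia|lia].
have H3 x : l1 < x < h1 \/ l2 < x < h2 -> x <> j /\ c < x < e.
  by case: Hcase => -[? ? ? ?]; lia.
have H4 : h1 <= e /\ h2 <= e by case: Hcase => -[? ? ? ?]; lia.
have Wc : 0 < ar s' aW c by rewrite FW //; lia.
have cases x : x < nb -> [\/ l1 <= x < h1 /\ ar s' aLB x = j,
    l2 <= x < h2 /\ ar s' aLB x = id |
    [/\ ~~ (c <= x < e), ar s' aLB x = ar s aLB x, ar s aLB x <> j & ar s aLB x <> id]].
  move=> Hx; rewrite FL; case: ifP => C1; first by constructor 1.
  case: (boolP (l2 <= x < h2)) => C2.
    by constructor 2; split=> //; apply: inj; rewrite -H12 C1 C2.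
  constructor 3; have nce : ~~ (c <= x < e) by rewrite -H12 C1.
  have [K1 K2 K3 K4 K5] := bl_LB B Hx; split=> //.
    by move=> E; rewrite E W0 in K4.
  by move=> E; rewrite E -Ec -Ee in K2; rewrite K2 in nce.
have [B'] : blocks mk' s'.
  split=> // [x Hx|x Hx i|x x' Hx|x x' Hx].
  - by rewrite EG (bl_log B).
  - rewrite {}/i; case: (cases x Hx) => [[C ->]|[C ->]|[C E N1 N2]].
    + rewrite Sj Ej; split=> //; first by lia.
      by case: H2 => -[->|->] _.
    + rewrite Si Ei; split=> //; [by lia|by rewrite FW|by case: H2 => _ [->|->]].
    + have [K1 K2 K3 K4 K5] := bl_LB B Hx.
      rewrite E; have [-> ->] := Fo _ N1 N2; split=> //; first by rewrite FW.
      by case: (ar s aST (ar s aLB x) =P j) => [->//|ne]; rewrite FW.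
  - case: (cases x Hx) => [[C ->]|[C ->]|[C E N1 N2]].
    + by rewrite Sj Ej FL => ->.
    + rewrite Si Ei => Hx'; rewrite FL ifF; first by apply: inj; rewrite -H12 Hx' orbT.
      by apply/negP => C1; apply: (H1 x').
    + rewrite E; have [-> ->] := Fo _ N1 N2 => Hx'; have Ex' := bl_in B Hx Hx'.
      rewrite FL; case: ifP => // C1; case: N2; rewrite -Ex'; apply: inj.
      by rewrite -H12 C1.
  - case: (cases x Hx) => [[C ->]|[C ->]|[C E N1 N2]].
    + by rewrite Sj Ej => Hx'; have [ne h] := H3 x' (or_introl Hx'); rewrite FW ?emp.
    + by rewrite Si Ei => Hx'; have [ne h] := H3 x' (or_intror Hx'); rewrite FW ?emp.
    + rewrite E; have [-> ->] := Fo _ N1 N2 => Hx'; rewrite FW ?(bl_empty B Hx Hx') // => Ex'.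
      by case: N2; rewrite -(bl_in B Hx (j' := j)) -?Eid //; move: Hx'; rewrite -Ex'; lia.
split=> //; first by rewrite cj.
(* Only the weights of [j] and [id] change, and that of [j] was 0 as its block was empty. *)
pose j1 := Ordinal Hj; pose i1 := Ordinal L1.
have ij1 : i1 != j1 by rewrite -val_eqE; apply/eqP.
rewrite (bigD1 j1) //= (bigD1 i1) //= [X in _ <= X](bigD1 j1) //= [X in _ <= _ + X](bigD1 i1) //=.
rewrite (eq_bigr (fun i : 'I_nb => weight s i)); last first.
  move=> i /andP[/negP ni /negP ni']; have [N1 N2] : nat_of_ord i <> j /\ nat_of_ord i <> id.
    by split=> E; [apply: ni|apply: ni']; rewrite -val_eqE /= E.
  by rewrite /weight; have [-> ->] := Fo _ N1 N2; rewrite FW.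
have -> : weight s j = 0 by rewrite /weight W0.
rewrite /weight Wj FW // L4 Sj Ej Si Ei -Ec -Ee.
have nl : nlogn (h1 - l1) + nlogn (h2 - l2) + minn (j - c) (e - j) <= nlogn (e - c).
  have -> : nlogn (h1 - l1) + nlogn (h2 - l2) = nlogn (j - c) + nlogn (e - j).
    by case: Hcase => -[-> -> -> ->] //; rewrite addnC.
  case: (leqP (j - c) (e - j)) => le.
    have := @nlogn_split (j - c) (e - j).
    have -> : j - c + (e - j) = e - c by lia.
    by apply; lia.
  have := @nlogn_split (e - j) (j - c).
  have -> : e - j + (j - c) = e - c by lia.
  by rewrite [nlogn (j - c) + _]addnC; apply; lia.
move: (\sum_(i < nb | _) _) => z; lia.
Qed.

Lemma unmarked_mark (mk : nat -> bool) (p : nat) : p < m -> mk p = false ->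
  unmarked mk = (unmarked (fun q : nat => mk q || (q == p))).+1.
Proof.
move=> pm mp; rewrite /unmarked.
set P := fun q => ~~ (mk q || (q == p)).
have := count_predUI P (pred1 p) (iota 0 m).
rewrite (@eq_count _ (predI _ _) pred0) ?count_pred0 => [|q /=]; last first.
  by rewrite /P; case: eqP; rewrite ?orbT ?andbF.
rewrite count_uniq_mem ?iota_uniq // mem_iota /= pm addn1 addn0 => <-.
by apply: eq_count => q /=; rewrite /P; case: eqP => [->|_]; rewrite ?mp ?orbF ?orbT.
Qed.

(** Of the 400 freed by the mark, 200 are handed back to the caller for the rest of its turn. *)
Lemma wp_mark (mk : nat -> bool) Q k s (p : nat) (mk' := fun q : nat => mk q || (q == p)) :
  blocks mk s -> rg s 9 = p -> p < m -> mk p = false -> potential mk s <= k ->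
  (forall s' k', blocks mk' s' ->
     k + potential mk' s' + 200 <= k' + potential mk s ->
     (forall r, r < 9 \/ r = 15 -> rg s' r = rg s r) ->
     (forall a x : nat, a \notin [:: aW; aLB; aST; aEN] -> ar s' a x = ar s a x) ->
     ou s' = ou s -> Q k' s') ->
  wp mark Q k s.
Proof.
move=> B E9 pm mp Hk HQ; have Nb := nb_le; have Eb := bl_b B.
have Eu := unmarked_mark pm mp; rewrite -/mk' in Eu.
set Phi := \sum_(i < nb) weight s i.
have EP : potential mk s = 20 * Phi + 400 * (unmarked mk').+1 by rewrite /potential Eu.
have Hk4 : 20 * Phi + 400 <= k by move: Hk; rewrite EP; lia.
have [j [r [Ej hm hx Hj hd2]]] : exists j r, [/\ j = p %/ b, p = j * b + r, r < b, j < nb & j <= p].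
  exists (p %/ b), (p %% b); split=> //; [exact: divn_eq|by rewrite ltn_pmod|exact: block_lt|exact: leq_div].
have EW := bl_W B Hj; set f := fun a => mk (j * b + a) in EW.
have fr : f r = false by rewrite /f -hm.
have ES := bits_set hx fr; have SL := bits_lt b (fun a => f a || (a == r)); rewrite -ES in SL.
have r2 : 2 ^ r > 0 by rewrite expn_gt0.
have M0 : mk' 0 by rewrite /mk' (bl_mk0 B).
have Mm q : mk' q -> q < m by case/orP => [/(bl_mk B)|/eqP->].
have MW i : i < nb -> (if i == j then bits b f + 2 ^ r else ar s aW i) =
    bits b (fun a => mk' (i * b + a)).
  move=> Hi; case: (i =P j) => [->|ne].
    by rewrite ES; apply: eq_bits => a ab; rewrite /mk' hm eqn_add2l.
  rewrite (bl_W B) //; apply: eq_bits => a ab; rewrite /mk'; case: eqP => [E|]; last by rewrite orbF.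
  by case: ne; rewrite Ej -E divnMDl // divn_small // addn0.
have Pt q : 0 < 2 ^ q by rewrite expn_gt0.
stp x Ex; rewrite /= E9 Eb -Ej in Ex; subst x.
stp x Ex; rewrite /= Eb in Ex; subst x.
stp x Ex; rewrite /= E9 in Ex; have {}Ex : x = r by lia.
rewrite {}Ex. st. stp y Ey; rewrite /= mul1n in Ey; subst y.
stp W EW'; rewrite /= EW in EW'. stp y Ey; rewrite /= EW' addnC in Ey. st.
set s1 := seta _ _ _ _.
have A1 a x0 : ar s1 a x0 = if (a == aW) && (x0 == j) then y else ar s a x0 by [].
have [R9 R10 R13 R15] : [/\ rg s1 9 = p, rg s1 10 = j, rg s1 13 = W & rg s1 15 = b] by [].
have R1 r0 : r0 < 9 \/ r0 = 15 -> rg s1 r0 = rg s r0.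
  by case=> [|->//]; case: r0 => [|[|[|[|[|[|[|[|[|r0]]]]]]]]].
have O1 : ou s1 = ou s by [].
move: s1 A1 R9 R10 R13 R15 R1 O1 => s1 A1 R9 R10 R13 R15 R1 O1.
have Wj1 : 0 < ar s1 aW j by rewrite A1 !eqxx Ey addn_gt0 r2 orbT.
have MW1 i : i < nb -> ar s1 aW i = bits b (fun a => mk' (i * b + a)).
  by move=> Hi; rewrite -MW // A1 /= Ey.
have FW1 i : i <> j -> ar s1 aW i = ar s aW i by move=> ne; rewrite A1 /= (negbTE (introN eqP ne)).
have A1' a x0 : a <> aW -> ar s1 a x0 = ar s a x0 by move=> ne; rewrite A1 (negbTE (introN eqP ne)).
split; first by lia.
(* A nonzero old mask means that the block already starts an interval, so intervals and weights stay
   as they are. *)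
rewrite [ev_cond _ _]/= R13; case: ifP => C.
  have W0 i : (0 < ar s1 aW i) = (0 < ar s aW i).
    by rewrite A1 /=; case: eqP => [->|//]; rewrite EW -EW' C Ey addn_gt0 -EW' C.
  apply: wp_skip; apply: HQ => //; last first.
  - by move=> a x0 Ha; rewrite A1'// => E; rewrite E in Ha.
  - have -> : potential mk' s1 = 20 * Phi + 400 * unmarked mk'.
      congr (_ * _ + _); apply: eq_bigr => i _; by rewrite /weight W0 !A1'.
    by rewrite EP; lia.
  split=> //.
  - by move=> x0 Hx0; rewrite A1' // (bl_log B).
  - move=> i Hi i'; rewrite {}/i' !(A1' aLB, A1' aST, A1' aEN) // !W0; exact: (bl_LB B).
  - move=> i i' Hi; rewrite !A1' //; exact: (bl_in B).
  - move=> i i' Hi; rewrite !(A1' aLB, A1' aST, A1' aEN) // => Hi'; rewrite FW1 ?(bl_empty B Hi Hi') // => E.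
    by have := bl_empty B Hi Hi'; rewrite E EW -EW' => E0; rewrite E0 in C.
have W0 : ar s aW j = 0 by rewrite EW -EW'; lia.
have [L1 /andP[L2 L2'] L3 L4 L5] := bl_LB B Hj.
set id := ar s aLB j in L1 L2 L2' L3 L4 L5.
set c := ar s aST id in L2 L5; set e := ar s aEN id in L2' L3.
have nid : (id == j) = false by apply/eqP => E; rewrite E W0 in L4.
have cj : c < j by rewrite ltn_neqAle L2 andbT; apply/eqP => E; rewrite E W0 in L5.
have SB := split_blocks (mk' := mk') (id := id) (c := c) (e := e) B Hj W0 erefl erefl erefl.
rewrite /split_block.
stp i Ei; rewrite /= R10 A1' // -/id in Ei.
stp c' Ec; rewrite /= Ei A1' // -/c in Ec.
stp e' Ee; rewrite /= Ei A1' // -/e in Ee.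
rewrite {}Ei {}Ec {}Ee.
stp u Eu'; rewrite /= R10 in Eu'; stp v Ev; rewrite /= R10 in Ev.
have fin lo hi lo2 hi2 k2 s2 :
    (lo, hi, lo2, hi2) = (j, e, c, j) \/ (lo, hi, lo2, hi2) = (c, j, j, e) ->
    hi - lo = minn (j - c) (e - j) -> k <= k2 + 150 ->
    rg s2 10 = j -> rg s2 12 = lo -> rg s2 13 = hi ->
    (forall r, r < 9 \/ r = 15 -> rg s2 r = rg s r) -> ou s2 = ou s ->
    (forall a x, a \notin [:: aST; aEN] -> ar s2 a x = ar s1 a x) ->
    ar s2 aST j = lo -> ar s2 aEN j = hi -> ar s2 aST id = lo2 -> ar s2 aEN id = hi2 ->
    (forall i, i <> j -> i <> id -> ar s2 aST i = ar s aST i /\ ar s2 aEN i = ar s aEN i) ->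
    wp (Seq relabel Skip) Q k2 s2.
  move=> Hc Hmin Hk2 F10 F12 F13 Fr Fo Fa Sj Ej' Si Ei' Fe.
  have lohi : lo <= hi <= nb by case: Hc => -[-> -> _ _]; lia.
  (* The budget is only known to cover the old potential, so the relabelling is bounded by it: the
     shorter side is at most [e - c], which is at most the weight of the interval since its
     logarithm is at least 1. *)
  have Hmin2 : minn (j - c) (e - j) <= Phi.
    have wid : nlogn (e - c) <= Phi.
      rewrite /Phi (bigD1 (Ordinal L1)) //= {1}/weight L4; exact: leq_addr.
    have e2 : 2 <= e - c by lia.
    have lg1 : 1 <= trunc_log 2 (e - c) by rewrite trunc_log_gt0.
    by apply: leq_trans wid; rewrite /nlogn; apply: leq_trans (leq_mul (leqnn (e - c)) lg1); lia.
  apply: (wp_relabel (lo := lo) (hi := hi) (j := j)) => //; first by rewrite Hmin; lia.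
  move=> s3 k3 Ek3 GL Ga Go Gr.
  have G2 a x0 : a \notin [:: aW; aLB; aST; aEN] -> ar s3 a x0 = ar s a x0.
    move=> Ha; rewrite Ga; last by move=> E; rewrite E in Ha.
    rewrite Fa; last by move: Ha; rewrite !inE !negb_or => /and4P[_ _ -> ->].
    by rewrite A1' // => E; rewrite E in Ha.
  have G2W x0 : ar s3 aW x0 = ar s1 aW x0 by rewrite Ga // Fa.
  have [|||||||||||||B' _ _ le] := SB s3 lo hi lo2 hi2 Hc; rewrite ?Ga //.
  - by move=> x0; rewrite GL Fa // A1'.
  - by move=> i0 ni nj; rewrite !Ga //; apply: Fe.
  - by move=> i0 ni; rewrite G2W FW1.
  - by rewrite Fa.
  - by rewrite Gr ?Fr ?Eb //; right.
  - by move=> x0; rewrite G2.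
  - by move=> i0 Hi; rewrite G2W MW1.
  apply: wp_skip; apply: HQ => //.
  - by rewrite EP {1}/potential; move: le Ek3; rewrite -/Phi Hmin; move: (\sum_(i < nb) _) => z; lia.
  - by move=> r0 Hr0; rewrite Gr ?Fr //; lia.
  - by rewrite Go.
have nid2 : (j == id) = false by rewrite eq_sym.
have arN (a x0 : nat) : a \notin [:: aST; aEN] -> (a == aST) = false /\ (a == aEN) = false.
  by rewrite !inE negb_or => /andP[/negbTE-> /negbTE->].
apply: wp_if; first (by lia); move=> D; rewrite /= Eu' Ev in D.
- st. st. st. stp z Ez; rewrite /= R10 addn0 in Ez.
  apply: wp_skip; apply: (fin j e c j) => //=; rewrite ?R10 ?eqxx ?nid ?nid2 //.
  + by left.
  + by lia.
  + by lia.
  + move=> r0 Hr0; rewrite -R1 //.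
    by case: Hr0 => [|->//]; case: r0 => [|[|[|[|[|[|[|[|[|r0]]]]]]]]].
  + by move=> a x0 /(arN a x0)[-> ->].
  + by move=> i0 n1 n2; rewrite (negbTE (introN eqP n1)) ?(negbTE (introN eqP n2)) !A1'.
- st. st. st. stp z Ez; rewrite /= R10 addn0 in Ez.
  apply: wp_skip; apply: (fin c j j e) => //=; rewrite ?R10 ?eqxx ?nid ?nid2 ?A1' //.
  + by right.
  + by lia.
  + by lia.
  + move=> r0 Hr0; rewrite -R1 //.
    by case: Hr0 => [|->//]; case: r0 => [|[|[|[|[|[|[|[|[|r0]]]]]]]]].
  + by move=> a x0 /(arN a x0)[-> ->].
  + by move=> i0 n1 n2; rewrite (negbTE (introN eqP n1)) ?(negbTE (introN eqP n2)) !A1'.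
Qed.

End Blocks.

(** * The position heap *)

Section PHeap.
Variable S : seq nat.
Notation n := (size S).

Lemma size_pheap i : size (pheap S i) = i.+1.
Proof. by elim: i => //= i IH; rewrite /ph_insert size_rcons IH. Qed.

Lemma nth_pheap i k j : j <= i -> i <= k -> nth [::] (pheap S k) j = nth [::] (pheap S i) j.
Proof.
move=> ji; elim: k => [|k IH]; first by rewrite leqn0 => /eqP->.
rewrite leq_eqVlt => /orP[/eqP->//|ik].
by rewrite /= /ph_insert nth_rcons size_pheap ifT ?IH //; lia.
Qed.

Lemma nil_pheap i : [::] \in pheap S i.
Proof. by elim: i => // i IH; rewrite /= /ph_insert mem_rcons inE IH orbT. Qed.

Lemma sub_pheap i x : x \in pheap S i -> x \in pheap S i.+1.
Proof. by move=> Hx; rewrite /= /ph_insert mem_rcons inE Hx orbT. Qed.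

(** Closure under prefixes: [find] returns the first missing length, so all shorter prefixes of a
    new label are already present. *)
Lemma pheap_take i k x : x \in pheap S i -> take k x \in pheap S i.
Proof.
elim: i x => [|i IH] x; first by rewrite inE => /eqP->; rewrite mem_seq1.
rewrite -[pheap S i.+1]/(ph_insert S (pheap S i) i.+1) {1}/ph_insert mem_rcons inE.
case/orP=> [/eqP->|/IH/sub_pheap//].
set s := suffix_at S i.+1; set r := find _ _.
case: (leqP r k) => rk.
  rewrite take_oversize; last by rewrite size_take; case: ifP; lia.
  by rewrite /ph_insert mem_rcons mem_head.
rewrite take_takel; last by lia.
apply: sub_pheap; have := before_find 0 rk.
have rs : r <= (size s).+1 by have := find_size (fun k => take k s \notin pheap S i) (iota 0 (size s).+1); rewrite size_iota.
by rewrite nth_iota ?add0n => [/negbFE|]; last lia.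
Qed.

Lemma pheap_prefix i j : 0 < j <= i -> prefix (nth [::] (pheap S i) j) (suffix_at S j).
Proof.
move=> /andP[j0 ji]; rewrite (nth_pheap (i := j)) //; case: j j0 {ji} => // j _.
by rewrite /= /ph_insert nth_rcons size_pheap ltnn eqxx prefix_take.
Qed.

(** By prefix closure, a present prefix followed by a missing one determines where [find] stops. *)
Lemma pheap_new i c (s := suffix_at S i.+1) : c < size s ->
  take c s \in pheap S i -> take c.+1 s \notin pheap S i ->
  pheap S i.+1 = rcons (pheap S i) (take c.+1 s).
Proof.
move=> cs H1 H2; rewrite /= /ph_insert -/s; set p := fun k => _; congr (rcons _ (take _ _)).
have -> : iota 0 (size s).+1 = iota 0 c.+1 ++ iota c.+1 (size s - c).
  by rewrite -iotaD; congr iota; lia.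
have E : has p (iota 0 c.+1) = false.
  apply/hasP => -[k]; rewrite mem_iota /p => Hk /negP; apply.
  have kc : k <= c by case/andP: Hk.
  by rewrite -(take_takel s kc); apply: (pheap_take k H1).
rewrite find_cat E size_iota.
have -> : size s - c = (size s - c.+1).+1 by lia.
by rewrite /= /p H2 addn0.
Qed.

Hypothesis HS : end_marked S.

(** Heap labels are prefixes of earlier suffixes, and no suffix is a prefix of another; hence the
    edge of a leaf still has room when its suffix is inserted. *)
Lemma suffix_notin_pheap i : i < n -> suffix_at S i.+1 \notin pheap S i.
Proof.
move=> Hi; apply/negP => /(nthP [::])[j]; rewrite size_pheap => Hj E.
case: (posnP j) => [j0|j0].
  by move: E; rewrite j0 (nth_pheap (i := 0)) //= => /(congr1 size); rewrite size_suffix //=; lia.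
have := @pheap_prefix i j; rewrite E j0 => /(_ Hj) P.
by have := @suffix_prefix_eq _ HS i.+1 j _ _ P; lia.
Qed.

End PHeap.

Arguments pheap : simpl never.

(* In [expand] and [insert], register 6 holds the new heap label and register 7
   the suffix tree node whose entering edge receives it. *)
Definition expand : cmd := code [:: LdT 1 8 7]
 (Seq (While (Pos 8) (code [:: StA aLAST 8 6; LdA aPRE 9 8] (Seq mark (code [:: LdT 2 8 8] Skip)))) Skip).

Definition insert : cmd := code
  [:: LdA aLAST 8 7; StO 0 6 8; StA aLAST 7 6; LdT 3 9 7; LdA aCNT 10 7; Bin Add 9 9 (Reg 10);
      Bin Sub 9 9 (Cst 1); LdS 11 9; StO 1 6 11; Bin Add 10 10 (Cst 1); StA aCNT 7 10; LdT 4 11 7]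
  (If (Lt 10 11) Skip expand).

Definition insert_all : cmd :=
  Seq (While (Lt 6 0) (code [:: Bin Add 6 6 (Cst 1); LdA aLF 8 6] (Seq find_pred insert))) Skip.

Definition reach_all : cmd := code [:: SetC 6 0]
 (Seq (While (Lt 6 0) (code [:: Bin Add 6 6 (Cst 1); LdA aLF 8 6]
    (Seq find_pred (code [:: LdA aLAST 8 7; StO 2 6 8] Skip)))) Skip).

(** * The invariant linking the growing heap to the suffix tree *)

Section Heap.
Variables (S : seq nat) (m : nat) (T : nat -> nat -> nat).
Variables (lab : nat -> seq nat) (ch : nat -> seq nat).
Hypothesis HS : end_marked S.
Hypothesis HT : stree S m T lab ch.
Set Default Proof Using "All".
Notation n := (size S).
Notation L := (suffixes_of S).
Notation par := (T 0).
Notation order := (order S lab ch).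
Notation num := (num S lab ch).
Notation H := (pheap S).

(** A freshly marked node has count 0, and its [aLAST] then names the heap node at the upper end of
    its edge, the label of the parent. The bound [ou s 0 i' < i'] keeps the written entries
    meaningful while [H] grows at its end. *)
Record heap_inv (i : nat) (mk : nat -> bool) (s : store) : Prop := HeapInv {
  hi_mark : forall v, v < m -> mk (num v) = (v == 0) || (lab (par v) \in H i);
  hi_last : forall v, 0 < v < m -> mk (num v) ->
    [/\ ar s aLAST v <= i,
      nth [::] (H i) (ar s aLAST v) = take (size (lab (par v)) + ar s aCNT v) (lab v),
      ar s aCNT v <= T 4 v &
      ar s aCNT v < T 4 v -> take (size (lab (par v)) + ar s aCNT v).+1 (lab v) \notin H i];
  hi_cnt : forall v, 0 < v < m -> mk (num v) = false -> ar s aCNT v = 0;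
  hi_out : forall i', 0 < i' <= i -> let p := nth [::] (H i) i' in
    [/\ ou s 0 i' < i', nth [::] (H i) (ou s 0 i') = take (size p).-1 p & ou s 1 i' = last 0 p] }.

Lemma edge_size v : 0 < v < m -> size (lab v) = size (lab (par v)) + T 4 v.
Proof. by move=> Hv; have [_ _ -> _] := edgeP HT Hv; have := par_size HS HT Hv; lia. Qed.

Lemma hi_last_mem i mk s v : heap_inv i mk s -> 0 < v < m -> mk (num v) ->
  take (size (lab (par v)) + ar s aCNT v) (lab v) \in H i.
Proof.
by move=> B Hv Mv; have [h1 <- _ _] := hi_last B Hv Mv; rewrite mem_nth // size_pheap.
Qed.

Lemma hi_full i mk s v : heap_inv i mk s -> 0 < v < m -> mk (num v) ->
  (lab v \in H i) = (ar s aCNT v == T 4 v).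
Proof.
move=> B Hv Mv; have Z := edge_size Hv; have M1 := hi_last_mem B Hv Mv.
have [h1 h2 h3 h4] := hi_last B Hv Mv; apply/idP/eqP => [Hl|E].
  apply/eqP; rewrite eqn_leq h3 leqNgt; apply/negP => /h4/negP; apply.
  exact: pheap_take.
by rewrite E -Z take_size in M1.
Qed.

(* The nearest marked ancestor in the tree is the preceding mark in preorder. *)
Lemma marked_ancestor i mk s l p : heap_inv i mk s -> l < m -> lab l \in L ->
  mk p -> p <= num l -> (forall p', mk p' -> p' <= num l -> p' <= p) ->
  let v := nth 0 order p in
  [/\ 0 < v < m, mk (num v), prefix (lab v) (lab l) & v = l \/ lab v \notin H i].
Proof.
move=> B Hl Ll Mp pl pmax v.
have pm : p < m by apply: leq_ltn_trans pl (num_lt HS HT Hl).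
have vm : v < m by apply: (order_lt HS HT).
have nv : num v = p by apply: (num_nth HS HT).
have l0 : l <> 0 by move=> E; have := root_not_leaf HS HT; rewrite -E Ll.
suff [u [um Mu Pu Hu]] : exists u, [/\ u < m, mk (num u), prefix (lab u) (lab l) & u = l \/ lab u \notin H i].
  suff E : v = u.
    rewrite E; split=> //; rewrite um andbT lt0n; apply/eqP => u0.
    by case: Hu => [ul|]; [rewrite -ul in l0|rewrite u0 (lab0 HT) nil_pheap].
  have up : num u <= p by apply: pmax => //; apply: (num_prefix_le HS HT).
  have Puv : prefix (lab u) (lab v).
    by apply: (num_interval HS HT um vm Hl Pu); rewrite nv up pl.
  case: Hu => [E|Hu].
    apply: (num_inj HS HT) => //; apply/eqP; rewrite eqn_leq nv up andbT.
    by rewrite E.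
  case: (v =P u) => // ne.
  have lt : size (lab u) < size (lab v).
    rewrite ltn_neqAle prefix_size_le // andbT; apply/eqP => E; apply: ne.
    by apply: (lab_inj HT) => //; apply/esym; apply: prefix_antisym; rewrite ?E.
  have Hv : 0 < v < m by rewrite vm andbT lt0n; apply/eqP => E; rewrite E (lab0 HT) in lt.
  (* A mark strictly below [u] would put the label of its parent, and with it the prefix [lab u], in
     the heap. *)
  have := hi_mark B vm; rewrite nv Mp => /esym/orP[/eqP E|Hpv]; first by rewrite E in Hv.
  case/negP: Hu; have le := par_max HS HT Hv um Puv lt.
  have P := prefix_comparable Puv (par_prefix HS HT Hv) le.
  by rewrite -(prefix_takeE P) pheap_take.
(* Climbing from the leaf: the parent of an unmarked node has a label outside the heap, so the first
   marked node met is the leaf itself or is not in the heap. The marked root ends the climb. *)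
elim: {l l0}(size (lab l)) {-2}l (leqnn (size (lab l))) Hl {Ll pl pmax} => [|k IH] l hk Hl.
  have l0 : l = 0 by case: (node_cases HS HT Hl) => //; lia.
  by exists l; rewrite l0 prefix_refl (num0 HS HT); split=> //; [lia|rewrite -(num0 HS HT) (hi_mark B) //; lia|left].
case Ml : (mk (num l)); first by exists l; rewrite Ml prefix_refl; split=> //; left.
have := hi_mark B Hl; rewrite Ml => /esym/norP[l0 Hpl].
have Hl' : 0 < l < m by lia.
have sz := par_size HS HT Hl'.
have [|u [um Mu Pu Hu]] := IH (par l) _ (par_lt HT Hl'); first by lia.
exists u; split=> //; first by apply: prefix_trans Pu (par_prefix HS HT Hl').
by right; case: Hu => [->|].
Qed.

Lemma insertion_point i mk s l v : heap_inv i mk s -> i < n -> l < m -> lab l = suffix_at S i.+1 ->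
  0 < v < m -> mk (num v) -> prefix (lab v) (lab l) -> v = l \/ lab v \notin H i ->
  ar s aCNT v < T 4 v /\
  H i.+1 = rcons (H i) (take (size (lab (par v)) + ar s aCNT v).+1 (lab v)).
Proof.
move=> B Hi Hl El Hv Mv P Hc; have [h1 h2 h3 h4] := hi_last B Hv Mv.
have nf : lab v \notin H i by case: Hc => // ->; rewrite El suffix_notin_pheap.
have lt : ar s aCNT v < T 4 v.
  by rewrite ltn_neqAle h3 andbT; rewrite (hi_full B Hv Mv) in nf.
split=> //; have Z := edge_size Hv; have M1 := hi_last_mem B Hv Mv.
rewrite El in P; set c := size (lab (par v)) + _ in M1 h4 *.
have cz : c < size (lab v) by rewrite Z ltn_add2l.
have PN := @pheap_new S i c; cbv zeta in PN; rewrite (prefix_takeW P (ltnW cz)) (prefix_takeW P cz) in PN.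
apply: PN => //; last exact: h4.
exact: leq_trans (prefix_size_le P).
Qed.

(** The new label [z] lies on the edge of [v] and, by [edge_unique], on no other, so the data of the
    other marked edges remain valid. [nch] lists the nodes to be marked when this edge becomes
    full. *)
Lemma heap_inv_step i mk s v mk' s' (nch := if (ar s aCNT v).+1 == T 4 v then ch v else [::])
    (z := take (size (lab (par v)) + ar s aCNT v).+1 (lab v)) :
  heap_inv i mk s -> 0 < v < m -> mk (num v) -> ar s aCNT v < T 4 v ->
  H i.+1 = rcons (H i) z ->
  (forall q, mk' q = mk q || (q \in map num nch)) ->
  (forall x, ar s' aLAST x = if x \in v :: nch then i.+1 else ar s aLAST x) ->
  (forall x, ar s' aCNT x = if x == v then (ar s aCNT v).+1 else ar s aCNT x) ->
  (forall f x, f < 2 -> x <= i -> ou s' f x = ou s f x) ->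
  ou s' 0 i.+1 = ar s aLAST v -> ou s' 1 i.+1 = last 0 z ->
  heap_inv i.+1 mk' s'.
Proof.
move=> B Hv Mv lt Ez Emk EL EC EO O0 O1; have vm : v < m by lia.
have Z := edge_size Hv; have M1 := hi_last_mem B Hv Mv.
have [h1 h2 h3 h4] := hi_last B Hv Mv; have {}h4 := h4 lt.
have memH x : (x \in H i.+1) = (x == z) || (x \in H i) by rewrite Ez mem_rcons inE.
have sz : size z = (size (lab (par v)) + ar s aCNT v).+1.
  by rewrite size_takel // Z ltn_add2l.
have Pz : prefix z (lab v) by apply: prefix_take.
have full : ((ar s aCNT v).+1 == T 4 v) = (z == lab v).
  apply/eqP/eqP => E; last by have := congr1 size E; rewrite sz Z; lia.
  by apply: prefix_antisym => //; rewrite sz Z -E addnS.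
have nE x : x \in nch -> [/\ z = lab v, 0 < x < m & par x = v].
  by rewrite /nch full; case: eqP => // -> /(ch_bound HS HT vm)[].
have Hnch x : 0 < x < m -> (num x \in map num nch) = (x \in nch).
  move=> Hx; apply/mapP/idP => [[y yn]|xn]; last by exists x.
  by have [_ Hy _] := nE _ yn; move/(num_inj HS HT) => -> //; lia.
(* Only [v] can carry the label [z], a nonempty prefix of [lab v] strictly longer than the label of
   its parent. *)
have nlab x : 0 < x < m -> (lab (par x) == z) = (x \in nch).
  move=> Hx; have Hp := par_lt HT Hx; apply/eqP/idP => [E|]; last by move/nE => [-> _ ->].
  have Ev : par x = v.
    case: (node_cases HS HT Hp) => [p0|p0]; first by move: sz; rewrite -E p0 (lab0 HT).
    have Hp' : 0 < par x < m.
      by rewrite Hp andbT lt0n; apply/eqP => p00; rewrite p00 (lab0 HT) in p0.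
    apply: (lab_inj HT) => //; apply: prefix_antisym; first by rewrite E.
    rewrite leqNgt; apply/negP => lt2.
    by have := par_max HS HT Hv Hp; rewrite {1}E => /(_ Pz lt2); rewrite E sz; lia.
  by rewrite /nch full -E Ev eqxx -Ev; apply: (ch_mem HS HT).
have nchM x : x \in nch -> mk (num x) = false.
  move=> xn; have [E Hx px] := nE _ xn.
  rewrite (hi_mark B); last by lia.
  by rewrite px -E (negbTE h4) orbF; apply/eqP => x0; rewrite x0 in Hx.
have vn : v \notin nch.
  by apply/negP => /nE[_ _ E]; have := par_size HS HT Hv; rewrite E ltnn.
split.
- move=> x xm; rewrite Emk (hi_mark B xm) memH; case: (posnP x) => [->//|x0].
  have Hx : 0 < x < m by lia.
  by rewrite Hnch // nlab //; case: (x \in nch); case: (lab _ \in _); rewrite ?orbT ?orbF.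
- move=> x Hx; rewrite Emk Hnch // => Mx; rewrite EL EC inE.
  case: (x =P v) => [->|nv] /=.
    split=> //; first by rewrite Ez nth_rcons size_pheap ltnn eqxx addnS.
    move=> lt2; rewrite memH negb_or; apply/andP; split.
      apply/eqP => /(congr1 size); rewrite sz size_takel ?Z ?ltn_add2l // => /eqP.
      by rewrite eqSS eqn_add2l (gtn_eqF (ltnSn _)).
    by apply: contra h4 => /(pheap_take (size z)); rewrite take_takel ?sz // addnS leqW.
  case: (boolP (x \in nch)) => xn.
    have [Ev _ px] := nE _ xn.
    have c0 := hi_cnt B Hx (nchM _ xn).
    have Px : take (size (lab v)) (lab x) = lab v by rewrite -px; apply/prefix_takeE/(par_prefix HS HT).
    rewrite c0 addn0 px; split=> //; first by rewrite Ez nth_rcons size_pheap ltnn eqxx Px -Ev.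
    move=> lt2; rewrite memH negb_or; apply/andP; split.
      apply/eqP => E; have := congr1 size E; rewrite Ev size_takel.
        by move/eqP; rewrite (gtn_eqF (ltnSn _)).
      by have := par_size HS HT Hx; rewrite px.
    (* An older heap node on the edge of a child would have [z = lab v] as a prefix, but [z] was
       absent. *)
    apply: contra (h4 : z \notin H i) => /(pheap_take (size (lab v))); rewrite take_takel; last exact: leqnSn.
    by rewrite Px Ev.
  rewrite (negbTE xn) orbF in Mx.
  have [g1 g2 g3 g4] := hi_last B Hx Mx; have Zx := edge_size Hx; split=> //; first exact: leqW.
    by rewrite Ez nth_rcons size_pheap ltnS g1 g2.
  move=> lt2; rewrite memH negb_or g4 // andbT; apply/eqP => E.
  apply: nv; apply: (edge_unique HS HT Hx Hv (z := z)) => //.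
  + by rewrite -E prefix_take.
  + by rewrite -E size_takel ?Zx ?ltn_add2l // ltnS leq_addr.
  + by rewrite sz ltnS leq_addr.
- move=> x Hx; rewrite Emk Hnch // => /norP[/negbTE Mx xn]; rewrite EC.
  by case: eqP => [E|_]; [rewrite E Mv in Mx|apply: (hi_cnt B)].
- move=> i' Hi'; case: (ltngtP i' i.+1) => hc; [|lia|].
    rewrite /= !EO //; try lia.
    have Hi2 : 0 < i' <= i by lia.
    have [o1 o2 o3] := hi_out B Hi2.
    by rewrite Ez !nth_rcons !size_pheap !ifT //; lia.
  rewrite hc O0 O1 Ez !nth_rcons !size_pheap ltnn eqxx ltnS h1; split=> //.
  by rewrite h2 sz /= take_takel.
Qed.

Unset Default Proof Using.
End Heap.

(** * Correctness and cost of the insertion and reach loops *)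

Section HeapWP.
Variables (S : seq nat) (m : nat) (T : nat -> nat -> nat).
Variables (lab : nat -> seq nat) (ch : nat -> seq nat) (w b : nat).
Hypothesis HS : end_marked S.
Hypothesis HT : stree S m T lab ch.
Notation n := (size S).
Hypothesis Hw : 16 + n + 6 * m + 3 * n + 3 + 16 * (n + m + 2) < 2 ^ w.
Hypothesis b0 : 0 < b.
Hypothesis bm : 2 ^ b <= m.
Notation L := (suffixes_of S).
Notation par := (T 0).
Notation order := (order S lab ch).
Notation num := (num S lab ch).
Notation H := (pheap S).
Notation wp := (wp w n m (nth 0 S) T).
Notation blocks := (blocks m b).
Notation potential := (potential m b).
Notation heap_inv := (heap_inv S m T lab ch).

Record tables (s : store) : Prop := Tables {
  tb_order : forall p, p < m -> ar s aORD p = nth 0 order p;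
  tb_num : forall v, v < m -> ar s aPRE v = num v;
  tb_leaf : forall v, v < m -> lab v \in L -> ar s aLF (T 5 v) = num v;
  tb_n : rg s 0 = n;
  tb_m : rg s 1 = m }.

Lemma tables_ext s s' : (forall a x, 0 < a < 4 -> ar s' a x = ar s a x) ->
  rg s' 0 = rg s 0 -> rg s' 1 = rg s 1 -> tables s -> tables s'.
Proof. by move=> Ea E0 E1 [t1 t2 t3 t4 t5]; split=> *; rewrite ?Ea ?E0 ?E1 //; auto. Qed.

Lemma blocks_ext mk s s' : (forall a x, 3 < a < 9 -> ar s' a x = ar s a x) ->
  rg s' 15 = rg s 15 -> blocks mk s -> blocks mk s' /\ potential mk s' = potential mk s.
Proof.
move=> Ea E15 B; split.
  case: B => *; split; rewrite ?E15 //.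
  - by move=> *; rewrite !Ea //; auto.
  - by move=> *; rewrite !Ea //; auto.
  - by move=> j Hj /=; rewrite !(Ea aLB, Ea aST, Ea aEN, Ea aW) //; auto.
  - by move=> j j' Hj; rewrite !(Ea aLB, Ea aST, Ea aEN, Ea aW) //; auto.
  - by move=> j j' Hj; rewrite !(Ea aLB, Ea aST, Ea aEN, Ea aW) //; eauto.
congr (_ * _ + _); apply: eq_bigr => i _.
by rewrite /weight !(Ea aLB, Ea aST, Ea aEN, Ea aW).
Qed.

(** The 200 handed back by [wp_mark] pay for the rest of each turn, so beyond the potential only a
    constant is charged, whatever the number of children. *)
Lemma wp_expand Q k s v i (mk : nat -> bool) :
  blocks mk s -> tables s -> rg s 7 = v -> rg s 6 = i -> v < m ->
  (forall c, c \in ch v -> mk (num c) = false) -> potential mk s + 100 <= k ->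
  (forall (mk' : nat -> bool) s' k', blocks mk' s' ->
     (forall q, mk' q = mk q || (q \in map num (ch v))) ->
     k + potential mk' s' <= k' + potential mk s + 100 ->
     (forall x, ar s' aLAST x = if x \in ch v then i else ar s aLAST x) ->
     (forall a x : nat, a \notin [:: aW; aLB; aST; aEN; aLAST] -> ar s' a x = ar s a x) ->
     ou s' = ou s -> (forall r, r < 8 -> rg s' r = rg s r) -> Q k' s') ->
  wp expand Q k s.
Proof.
move=> B Tb E7 E6 Hv Mc Hk HQ; rewrite /expand.
stp c0 Ec; rewrite /= E7 (ch_head HT) // in Ec.
pose I k' s' := exists j (mkj : nat -> bool),
  [/\ j <= size (ch v), rg s' 8 = nth 0 (ch v) j, blocks mkj s',
     forall q, mkj q = mk q || (q \in map num (take j (ch v))) &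
     k + potential mkj s' <= k' + potential mk s + 8] /\
  [/\ forall x, ar s' aLAST x = if x \in take j (ch v) then i else ar s aLAST x,
     forall a x : nat, a \notin [:: aW; aLB; aST; aEN; aLAST] -> ar s' a x = ar s a x,
     ou s' = ou s & forall r, r < 8 -> rg s' r = rg s r].
refine (wp_while (I := I) _ _).
  exists 0, mk; rewrite take0; split.
    have [B' P'] := @blocks_ext mk s (setr s 8 c0) (fun a x _ => erefl) erefl B.
    by split=> //; [move=> q; rewrite orbF|rewrite P'; lia].
  by split=> // -[|[|[|[|[|[|[|[|r]]]]]]]].
move=> k' s' [j [mkj [[Hj E8 Bj Mj Ek] [FL Fa Fo Fr]]]]; split; first by lia.
rewrite [ev_cond _ _]/= E8; case: (ltnP j (size (ch v))) => hc; last first.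
  rewrite nth_default // ltnn; rewrite take_oversize // in Mj FL.
  by apply: wp_skip; apply: (HQ mkj) => //; lia.
have [/andP[c1 cm] pc] := nth_child HS HT Hv hc.
rewrite c1; set c := nth 0 (ch v) j in c1 cm pc E8 *.
have cn := num_lt HS HT cm.
have cv : c \in ch v by apply: mem_nth.
have cj : c \notin take j (ch v).
  have U : uniq (take j (ch v) ++ drop j (ch v)) by rewrite cat_take_drop (ch_uniq HT Hv).
  move: U; rewrite (drop_nth 0) // cat_uniq.
  by move=> /and3P[_ /hasPn h _]; apply: (h c); rewrite mem_head.
have chm x : x \in take j (ch v) -> x < m.
  by move=> /mem_take /(ch_bound HS HT Hv)[]; lia.
have mkc : mkj (num c) = false.
  rewrite Mj Mc //; apply/mapP => -[x xj] /(num_inj HS HT) E.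
  by move: cj; rewrite E ?xj // chm.
st. stp p Ep; rewrite /= in Ep.
have {}Ep : p = num c by rewrite Ep E8 Fa // (tb_num Tb).
set s2 := setr _ _ _.
have E2 a x : 3 < a < 9 -> ar s2 a x = ar s' a x by rewrite /s2 /=; case: eqP => // ->.
have [B2 P2] := @blocks_ext mkj s' s2 E2 erefl Bj.
apply: wp_seq; apply: (wp_mark (p := num c) _ _ Hw b0 bm B2) => //; first by rewrite P2; lia.
rewrite P2 => s3 k3 B3 Ek3 G1 G2 G3.
have R3 r : r < 9 -> rg s3 r = rg s' r.
  by move=> Hr; rewrite G1; [case: r Hr => [|[|[|[|[|[|[|[|[|r]]]]]]]]]|left].
stp d Ed; first by cbn; rewrite R3 // E8.
rewrite /= R3 // E8 (ch_next HT Hv hc) in Ed.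
apply: wp_skip; exists j.+1, (fun q => mkj q || (q == num c)).
have tk x : (x \in take j.+1 (ch v)) = (x \in take j (ch v)) || (x == c).
  by rewrite (take_nth 0 hc) mem_rcons inE orbC.
split; first split=> //.
- have [B4 _] := @blocks_ext _ s3 (setr s3 8 d) (fun a x _ => erefl) erefl B3; exact: B4.
- by move=> q; rewrite Mj (take_nth 0 hc) map_rcons mem_rcons inE -orbA [(q == _) || _]orbC.
- have [_ P4] := @blocks_ext _ s3 (setr s3 8 d) (fun a x _ => erefl) erefl B3.
  by rewrite P4; move: (potential _ _) Ek3 => z; lia.
split=> //=.
- move=> x; rewrite G2 // tk /s2 /= FL E8 -/c; case: eqP => [->|ne]; rewrite ?orbT ?orbF //.
  by rewrite Fr.
- move=> a x Ha; rewrite G2; last by move: Ha; rewrite !inE !negb_or => /and5P[-> -> -> -> _].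
  by rewrite /s2 /= Fa //; move: Ha; rewrite !inE !negb_or => /and5P[_ _ _ _ /negbTE->].
- by rewrite G3.
- by move=> r Hr; rewrite -(Fr _ Hr) -R3; [case: r Hr => [|[|[|[|[|[|[|[|r]]]]]]]]|lia].
Qed.

(** Edge starts count from 1 and [nth] from 0, hence the final [- 1]. *)
Lemma edge_char v c : 0 < v < m -> c < T 4 v ->
  T 3 v + c - 1 < n /\
  last 0 (take (size (lab (par v)) + c).+1 (lab v)) = nth 0 S (T 3 v + c - 1).
Proof.
move=> Hv Hc; have [h1 h2 _ h4] := edgeP HT Hv; have Z := edge_size HS HT Hv.
split; first by clear -h1 h2 Hc; lia.
have lt : size (lab (par v)) + c < size (lab v) by rewrite Z ltn_add2l.
rewrite (take_nth 0) // last_rcons -nth_drop -h4 nth_take // nth_drop; congr nth.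
by clear -h1; lia.
Qed.

Lemma wp_insert Q k s i v (mk : nat -> bool) :
  blocks mk s -> tables s -> heap_inv i mk s -> rg s 6 = i.+1 -> rg s 7 = v -> i < n ->
  0 < v < m -> mk (num v) -> ar s aCNT v < T 4 v ->
  H i.+1 = rcons (H i) (take (size (lab (par v)) + ar s aCNT v).+1 (lab v)) ->
  potential mk s + 300 <= k ->
  (forall (mk' : nat -> bool) s' k', blocks mk' s' -> tables s' -> heap_inv i.+1 mk' s' ->
     rg s' 6 = i.+1 -> k + potential mk' s' <= k' + potential mk s + 300 -> Q k' s') ->
  wp insert Q k s.
Proof.
move=> B Tb HI E6 E7 Hi Hv Mv lt EH Hk HQ; have /andP[v0 vm] := Hv.
have [h1 h2 _ h4] := edgeP HT Hv; have [g1 g2 g3 g4] := hi_last HI Hv Mv.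
have [ch1 ch2] := edge_char Hv lt; have Z := edge_size HS HT Hv; have Zv := node_size HS HT vm.
have T4n : T 4 v <= n by clear -Z Zv; lia.
rewrite /insert.
stp l El; rewrite /= E7 in El.
st. st.
stp t Et; rewrite /= E7 in Et.
stp u Eu; rewrite /= E7 in Eu.
stp t2 Et2; rewrite /= in Et2.
stp t3 Et3; rewrite /= in Et3.
have Et3' : t3 = T 3 v + ar s aCNT v - 1 by rewrite Et3 Et2 Et Eu.
stp x Ex; rewrite /= Et3' -ch2 in Ex.
st.
stp u2 Eu2; rewrite /= Eu addn1 in Eu2.
st.
stp e Ee; rewrite /= E7 in Ee.
set s1 := setr _ 11 e.
have A1 a y : ar s1 a y = if (a == aCNT) && (y == v) then u2
    else if (a == aLAST) && (y == v) then i.+1 else ar s a y by rewrite -E7 -E6.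
have O1 f y : ou s1 f y = if (f == 1) && (y == i.+1) then x
    else if (f == 0) && (y == i.+1) then l else ou s f y by rewrite -E6.
have [R0 R1 R6 R7 R10] : [/\ rg s1 0 = rg s 0, rg s1 1 = rg s 1, rg s1 6 = i.+1, rg s1 7 = v
  & rg s1 10 = u2] by [].
have [R11 R15] : rg s1 11 = e /\ rg s1 15 = rg s 15 by [].
move: s1 A1 O1 R0 R1 R6 R7 R10 R11 R15 => s1 A1 O1 R0 R1 R6 R7 R10 R11 R15.
have [B1 P1] : blocks mk s1 /\ potential mk s1 = potential mk s.
  by apply: blocks_ext => // a y Ha; rewrite A1; case: a Ha => [|[|[|[|[|[|[|[|[|a]]]]]]]]].
have Tb1 : tables s1.
  by apply: tables_ext Tb => // a y Ha; rewrite A1; case: a Ha => [|[|[|[|a]]]].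
pose nch := if (ar s aCNT v).+1 == T 4 v then ch v else [::].
have step (mk' : nat -> bool) s' : (forall q, mk' q = mk q || (q \in map num nch)) ->
    (forall y, ar s' aLAST y = if y \in nch then i.+1 else ar s1 aLAST y) ->
    (forall y, ar s' aCNT y = ar s1 aCNT y) -> ou s' = ou s1 -> heap_inv i.+1 mk' s'.
  move=> HM HL HC HO; apply: (heap_inv_step HS HT HI Hv Mv lt EH HM).
  - move=> y; rewrite HL inE A1 /= -/nch; case: (y \in nch); first by rewrite orbT.
    by rewrite orbF; case: eqP.
  - by move=> y; rewrite HC A1 /= Eu2; case: eqP.
  - move=> f y hf hy; rewrite HO O1 (ltn_eqF (_ : y < i.+1)) //.
    by rewrite !andbF.
  - by rewrite HO O1 /= eqxx El.
  - by rewrite HO O1 /= eqxx Ex.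
split; first by clear -Hk; lia.
rewrite [ev_cond _ _]/= R10 R11 Eu2 Ee; case: ifP => C.
  have nc : nch = [::] by rewrite /nch (ltn_eqF C).
  apply: wp_skip; apply: (HQ mk) => //.
    by apply: step => // [q|y]; rewrite nc in_nil ?orbF.
  by rewrite P1; clear -Hk; lia.
have full : (ar s aCNT v).+1 == T 4 v by rewrite eqn_leq lt leqNgt C.
have nc : nch = ch v by rewrite /nch full.
have nf : lab v \notin H i by rewrite (hi_full HS HT HI Hv Mv) (ltn_eqF lt).
apply: (wp_expand B1 Tb1 R7 R6 vm).
- move=> c cv; have [/andP[c0 cm] pc] := ch_bound HS HT vm cv.
  by rewrite (hi_mark HI cm) pc (negbTE nf) orbF (gtn_eqF c0).
- by rewrite P1; clear -Hk; lia.
move=> mk' s' k' B' HM Ek HL Ha Ho Hr.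
apply: (HQ mk') => //.
- by apply: tables_ext Tb1 => [a y Ha'||]; rewrite ?Hr // Ha //; case: a Ha' => [|[|[|[|a]]]].
- by apply: step => //; rewrite ?nc // => y; rewrite Ha.
- by rewrite Hr.
- by move: Ek; rewrite P1; clear -Hk; lia.
Qed.

Lemma wp_find_leaf Q k s i l (mk : nat -> bool) :
  blocks mk s -> tables s -> heap_inv i mk s -> l < m -> lab l \in L -> rg s 8 = num l ->
  200 <= k ->
  (forall v s' k', blocks mk s' -> potential mk s' = potential mk s -> tables s' ->
     (forall i0, heap_inv i0 mk s -> heap_inv i0 mk s') -> 0 < v < m -> mk (num v) ->
     prefix (lab v) (lab l) -> v = l \/ lab v \notin H i ->
     rg s' 7 = v -> rg s' 6 = rg s 6 -> ar s' = ar s -> ou s' = ou s -> k <= k' + 200 -> Q k' s') ->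
  wp find_pred Q k s.
Proof.
move=> B Tb HI Hl Ll E8 Hk HQ; have nl := num_lt HS HT Hl.
apply: (wp_find_pred _ _ Hw b0 bm B) => //; first by rewrite E8.
rewrite E8 => p s' k' Ek Mp pl pmax R7 R A O.
have [h1 h2 h3 h4] := marked_ancestor HS HT HI Hl Ll Mp pl pmax.
have [||B' P'] := @blocks_ext mk s s' _ _ B; [by move=> a x _; rewrite A|by apply: R; right|].
apply: (HQ (nth 0 order p)) => //.
- apply: tables_ext Tb; [by move=> a x _; rewrite A|by apply: R; left|by apply: R; left].
- by move=> i0 [a1 a2 a3 a4]; split; rewrite ?A ?O.
- by rewrite R7 (tb_order Tb) //; apply: leq_ltn_trans pl nl.
- by apply: R; left.
Qed.

Lemma leaf_node s i : tables s -> i < n -> exists l, [/\ l < m, lab l = suffix_at S i.+1,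
  lab l \in L & ar s aLF i.+1 = num l].
Proof.
move=> Tb Hi; have Hi' : 0 < i.+1 <= n by [].
have [l lm El] := leaf_ex HS HT Hi'; have Ll : lab l \in L by rewrite El suffix_in.
by exists l; split=> //; rewrite -(tb_leaf Tb lm Ll) (leaf_label HS HT lm Hi' El).
Qed.

Lemma heap_inv_ext i mk s s' : (forall a x, 8 < a -> ar s' a x = ar s a x) ->
  (forall f x, f < 2 -> ou s' f x = ou s f x) -> heap_inv i mk s -> heap_inv i mk s'.
Proof.
move=> Ea Eo [h1 h2 h3 h4]; split=> //.
- by move=> v Hv Mv; rewrite !(Ea aLAST, Ea aCNT) //; apply: h2.
- by move=> v Hv Mv; rewrite !(Ea aLAST, Ea aCNT) //; apply: h3.
- by move=> j Hj /=; rewrite !Eo //; apply: h4.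
Qed.

Lemma wp_insert_all Q k s (mk : nat -> bool) :
  blocks mk s -> tables s -> heap_inv 0 mk s -> rg s 6 = 0 ->
  potential mk s + 600 * n.+1 <= k ->
  (forall (mk' : nat -> bool) s' k', blocks mk' s' -> tables s' -> heap_inv n mk' s' ->
     k <= k' + potential mk s + 600 * n.+1 -> Q k' s') ->
  wp insert_all Q k s.
Proof.
move=> B Tb HI E6 Hk HQ.
(* Per suffix 200 go to the query and 300 to the insertion; the remaining 100 cover the loop. *)
pose I k' s' := exists i (mk' : nat -> bool), [/\ i <= n, rg s' 6 = i, blocks mk' s', tables s' &
  heap_inv i mk' s'] /\ k + potential mk' s' <= k' + potential mk s + 600 * i.
refine (wp_while (I := I) _ _); first by exists 0, mk; split; rewrite ?muln0 ?addn0.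
move=> k' s' [i [mk' [[Hi F6 B' Tb' HI'] Ek]]]; split; first by clear -Hk Ek Hi; lia.
rewrite [ev_cond _ _]/= F6 (tb_n Tb'); case: ifP => C; last first.
  have Ei : i = n by apply/eqP; rewrite eqn_leq Hi leqNgt C.
  apply: wp_skip; apply: (HQ mk') => //; first by rewrite -Ei.
  by clear -Ek Hi; lia.
have [l [lm El Ll EL]] := leaf_node Tb' C.
stp i1 Ei1; rewrite /= F6 addn1 in Ei1; subst i1.
stp q Eqv; rewrite /= EL in Eqv.
set s1 := setr _ 8 q.
have [B1 P1] := @blocks_ext mk' s' s1 (fun a x _ => erefl) erefl B'.
have Tb1 : tables s1 by apply: tables_ext Tb'.
have HI1 : heap_inv i mk' s1 by apply: heap_inv_ext HI'.
have Hk2 : potential mk' s1 + 600 <= k' - 4 - 8 - 8 + 100.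
  by rewrite P1; clear -Hk Ek C; lia.
apply: wp_seq; apply: (wp_find_leaf B1 Tb1 HI1 lm Ll) => //; first by clear -Hk2; lia.
move=> v s2 k2 B2 P2 Tb2 HI2 Hv Mv Pv Hc R7 R6 A2 O2 Ek2.
have HI2' := HI2 _ HI1.
have [lt EH] := insertion_point HS HT HI2' C lm El Hv Mv Pv Hc.
apply: (wp_insert B2 Tb2 HI2' _ R7 C Hv Mv lt EH); first by rewrite R6.
  by rewrite P2; clear -Hk2 Ek2; lia.
move=> mk3 s3 k3 B3 Tb3 HI3 F3 Ek3; exists i.+1, mk3; split=> //.
by rewrite P2 P1 in Ek3; clear -Ek Ek2 Ek3 Hk2; lia.
Qed.

Definition reach_ok (s : store) (i : nat) : Prop :=
  [/\ ou s 2 i <= n, prefix (nth [::] (H n) (ou s 2 i)) (suffix_at S i) &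
    forall k, k <= n -> prefix (nth [::] (H n) k) (suffix_at S i) ->
      size (nth [::] (H n) k) <= size (nth [::] (H n) (ou s 2 i))].

(** If the edge is not full, a longer heap label along the leaf would by prefix closure contain its
    first missing position. A full edge occurs only when [v] is the leaf, beyond which no prefix
    extends. *)
Lemma deepest_prefix i mk s l v : heap_inv i mk s -> l < m -> 0 < v < m ->
  mk (num v) -> prefix (lab v) (lab l) -> v = l \/ lab v \notin H i ->
  forall k, k <= i -> prefix (nth [::] (H i) k) (lab l) ->
    size (nth [::] (H i) k) <= size (nth [::] (H i) (ar s aLAST v)).
Proof.
move=> HI Hl Hv Mv P Hc k Hk Pk; have [h1 h2 h3 h4] := hi_last HI Hv Mv.
have Z := edge_size HS HT Hv.
rewrite h2 size_takel; last by rewrite Z leq_add2l.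
set c := size (lab (par v)) + _ in h4 *; rewrite leqNgt; apply/negP => lt.
have Hz : nth [::] (H i) k \in H i by rewrite mem_nth // size_pheap.
move: h3; rewrite leq_eqVlt => /orP[/eqP E|lt2].
  have Ec : c = size (lab v) by rewrite /c E.
  case: Hc => [Ev|/negP]; last by rewrite (hi_full HS HT HI Hv Mv) E eqxx.
  by have := leq_trans lt (prefix_size_le Pk); rewrite Ec Ev ltnn.
have cz : c < size (lab v) by rewrite Z ltn_add2l.
case/negP: (h4 lt2).
by rewrite -(prefix_takeW P cz) (prefix_takeW Pk lt) pheap_take.
Qed.

Lemma wp_reach_all Q k s (mk : nat -> bool) :
  blocks mk s -> tables s -> heap_inv n mk s -> 300 * n.+1 <= k ->
  (forall s' k', heap_inv n mk s' -> (forall i, 0 < i <= n -> reach_ok s' i) -> Q k' s') ->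
  wp reach_all Q k s.
Proof.
move=> B Tb HI Hk HQ; rewrite /reach_all; st.
pose I k' s' := exists i, [/\ i <= n, rg s' 6 = i, blocks mk s', tables s' &
  heap_inv n mk s'] /\ [/\ forall j, 0 < j <= i -> reach_ok s' j & k <= k' + 250 * i + 8].
refine (wp_while (I := I) _ _).
  exists 0; split; last by split; [case|clear -Hk; lia].
  split=> //; [|exact: tables_ext Tb|exact: heap_inv_ext HI].
  by have [] := @blocks_ext mk s (setr s 6 0) (fun a x _ => erefl) erefl B.
move=> k' s' [i [[Hi F6 B' Tb' HI'] [HR Ek]]]; split; first by clear -Hk Ek Hi; lia.
rewrite [ev_cond _ _]/= F6 (tb_n Tb'); case: ifP => C; last first.
  have Ei : i = n by apply/eqP; rewrite eqn_leq Hi leqNgt C.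
  by apply: wp_skip; apply: HQ => //; rewrite -Ei.
have [l [lm El Ll EL]] := leaf_node Tb' C.
stp i1 Ei1; rewrite /= F6 addn1 in Ei1; subst i1.
stp q Eqv; rewrite /= EL in Eqv.
set s1 := setr _ 8 q.
have [B1 P1] := @blocks_ext mk s' s1 (fun a x _ => erefl) erefl B'.
have Tb1 : tables s1 by apply: tables_ext Tb'.
have HI1 : heap_inv n mk s1 by apply: heap_inv_ext HI'.
apply: wp_seq; apply: (wp_find_leaf B1 Tb1 HI1 lm Ll) => //.
  by clear -Hk Ek C; lia.
move=> v s2 k2 B2 P2 Tb2 HI2 Hv Mv Pv Hc R7 R6 A2 O2 Ek2.
have /andP[v0 vm] := Hv.
have Dp := deepest_prefix HI1 lm Hv Mv Pv Hc; rewrite El in Dp.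
have [g1 g2 _ _] := hi_last HI1 Hv Mv.
have F62 : rg s2 6 = i.+1 by rewrite R6.
have k24 : 20 <= k2 by clear -Hk Ek C Ek2; lia.
stp x Ex; rewrite /= R7 A2 in Ex.
st.
have Z := edge_size HS HT Hv.
apply: wp_skip; exists i.+1; rewrite /= F62.
split; first split=> //.
- by have [] := @blocks_ext mk s2 (seto (setr s2 8 x) 2 i.+1 x) (fun a x _ => erefl) erefl B2.
- exact: tables_ext Tb2.
- by apply: heap_inv_ext (HI2 _ HI1) => // f y; case: f => [|[|f]].
split; last by clear -Ek Ek2 k24; lia.
move=> j Hj; rewrite /reach_ok /=; case: (j =P i.+1) => [->|ne].
  split; rewrite ?Ex //; rewrite -El g2; apply: prefix_trans Pv; exact: prefix_take.
have Hj' : 0 < j <= i by clear -Hj ne; lia.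
by have := HR j Hj'; rewrite /reach_ok /= O2.
Qed.

End HeapWP.

(** * The complete program *)

(** The zeroed arrays already describe one interval labelled 0 that starts at block 0; only its end
    and the mark of the root, at position 0, are missing. Registers 6 and 7 prepare the call of
    [expand] that marks the children of the root under heap label 0. *)
Definition start_blocks : cmd := code
  [:: Bin Div 9 1 (Reg 15); Bin Add 9 9 (Cst 1); SetC 10 0; StA aEN 10 9;
      SetC 11 1; StA aW 10 11; SetC 6 0; SetC 7 0] Skip.

Definition body : cmd :=
  Seq dfs (Seq log_table (Seq start_blocks (Seq expand (Seq insert_all reach_all)))).

Definition init : seq instr :=
  [:: IConst 4 6; IMul 4 1 4; IAdd 4 4 0; IConst 5 16; IAdd 3 4 5;
      IConst 4 3; IMul 4 0 4; IAdd 2 3 4; IConst 4 3; IAdd 2 2 4].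

Definition program : seq instr := init ++ comp (size init) body ++ [:: IHalt].

Lemma stree_of_encoding S m M : suffix_tree_encoding S m M ->
  exists lab ch, stree S m (fun f v => M (rec_addr (size S) v + f)) lab ch.
Proof.
case=> _ _ _ _ [lab [ch [[l0 ln ls li] [p0 pp] [_ cc] [_ [_ ee]] lf]]].
exists lab, ch; split=> //.
- by move=> v Hv; rewrite addn0; case: (pp v Hv).
- by move=> v Hv; rewrite addn0; case: (pp v Hv).
- by move=> v Hv; case: (cc v Hv).
- by move=> v u Hv; rewrite addn0; case: (cc v Hv) => _ h _ _; apply: h.
- by move=> v Hv; case: (cc v Hv).
- by move=> v k Hv; case: (cc v Hv) => _ _ _ h; apply: h.
- by move=> v Hv; rewrite addn0; apply: ee.
Qed.

Definition store0 (n m : nat) : store :=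
  Store (fun r => if r == 0 then n else if r == 1 then m else 0) (fun _ _ => 0) (fun _ _ => 0).

Lemma run_init S m M0 w P :
  suffix_tree_encoding S m M0 -> arrB (size S) m + 16 * (size S + m + 2) < 2 ^ w ->
  code_at P 0 init ->
  exists2 M, run w P (size init) (State 0 M0) = State (size init) M &
    rel (size S) m (nth 0 S) (fun f v => M0 (rec_addr (size S) v + f)) (store0 (size S) m) M.
Proof.
move=> [En Em Es Ez _] Hw; set n := size S in En Em Es Ez Hw *.
rewrite /arrB /outB in Hw.
case=> h0 [h1 [h2 [h3 [h4 [h5 [h6 [h7 [h8 [h9 _]]]]]]]]].
eexists.
  rewrite runS (step_const _ h0); last by lia.
  rewrite runS (step_bin (b := Mul) h1); last by rewrite /= Em; lia.
  rewrite runS (step_bin (b := Add) h2); last by rewrite /= En Em; lia.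
  rewrite runS (step_const _ h3); last by lia.
  rewrite runS (step_bin (b := Add) h4); last by rewrite /= En Em; lia.
  rewrite runS (step_const _ h5); last by lia.
  rewrite runS (step_bin (b := Mul) h6); last by rewrite /= En; lia.
  rewrite runS (step_bin (b := Add) h7); last by rewrite /= En Em; lia.
  rewrite runS (step_const _ h8); last by lia.
  rewrite runS (step_bin (b := Add) h9); last by rewrite /= En Em; lia.
  by [].
set M := upd _ 2 _.
have EM a : a \notin [:: 2; 3; 4; 5] -> M a = M0 a.
  by rewrite !inE !negb_or => /and4P[/negbTE e2 /negbTE e3 /negbTE e4 /negbTE e5]; rewrite /M /= e2 e3 e4 e5.
have EM6 a : 5 < a -> M a = M0 a by move=> Ha; apply: EM; rewrite !inE; lia.
split.
- by rewrite EM.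
- by rewrite EM.
- by [].
- by [].
- by rewrite /M /= En Em /arrB /outB; lia.
- by rewrite /M /= En Em /outB; lia.
- move=> r /andP[r6 r16]; rewrite EM6 // Ez; last by lia.
  by rewrite /= !gtn_eqF //; lia.
- by move=> i Hi; rewrite EM6 ?Es //; lia.
- by move=> f v Hf Hv; rewrite EM6 ?/rec_addr //; lia.
- by move=> f i Hf Hi; rewrite EM6 ?Ez // /outB; lia.
- by move=> k j Hk; rewrite EM6 ?Ez // /arrB /outB; lia.
Qed.

Section Main.
Variables (S : seq nat) (m : nat) (T : nat -> nat -> nat).
Variables (lab : nat -> seq nat) (ch : nat -> seq nat) (w : nat).
Hypothesis HS : end_marked S.
Hypothesis HT : stree S m T lab ch.
Notation n := (size S).
Hypothesis Hw : 16 + n + 6 * m + 3 * n + 3 + 16 * (n + m + 2) < 2 ^ w.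
Notation wp := (wp w n m (nth 0 S) T).
Notation b := (trunc_log 2 m).
Notation H := (pheap S).

Let m1 : 1 < m := m_gt1 HS HT.

Lemma log_m : 0 < b /\ 2 ^ b <= m.
Proof. by rewrite trunc_log_gt0 /= m1 trunc_logP //; apply: ltnW. Qed.

Lemma bits_single (k : nat) : 0 < k -> bits k (fun a => a == 0) = 1.
Proof.
move=> k0; rewrite -(@eq_bits k (fun a => false || (a == 0))) //.
rewrite -(@bits_set k (fun=> false) 0) // expn0.
suff -> : bits k (fun=> false) = 0 by [].
by elim: k {k0} => //= k ->.
Qed.

Lemma bits_none (k : nat) f : (forall a, a < k -> f a = false) -> bits k f = 0.
Proof.
elim: k => //= k IH Hf; rewrite IH ?Hf // => a ak; apply: Hf; exact: ltnW.
Qed.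

Lemma start_inv s :
  rg s 15 = b -> (forall x, 0 < x <= m -> ar s aLG x = trunc_log 2 x) ->
  (forall j, ar s aW j = (j == 0)) -> (forall j, ar s aLB j = 0) -> (forall j, ar s aST j = 0) ->
  ar s aEN 0 = nb m b ->
  blocks m b (fun q => q == 0) s /\ potential m b (fun q => q == 0) s <= 460 * m + 20.
Proof.
move=> E15 EL EW EB ES EE; have [b0 bm] := log_m; split.
  split=> // [p /eqP->|j Hj|j Hj i|j j' Hj|j j' Hj].
  - exact: ltnW.
  - rewrite EW; case: j Hj => [|j] _ /=; first by rewrite bits_single.
    by rewrite bits_none // => a _; rewrite addn_eq0 muln_eq0 (gtn_eqF b0).
  - by rewrite /i EB ES EE Hj !EW.
  - by rewrite !EB.
  - by rewrite EB ES => /andP[j0 _]; rewrite EW (gtn_eqF j0).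
have U : unmarked m (fun q => q == 0) <= m.
  by apply: leq_trans (count_size _ _) _; rewrite size_iota.
(* The single interval weighs at most [(m / b + 1) (b + 1)], that is [m + m / b + b + 1] up to
   rounding, hence at most [3 m + 1]. It is here that [b = log m] makes the relabelling cost
   linear. *)
have W : \sum_(i < nb m b) weight s i <= 3 * m + 1.
  rewrite /nb big_ord_recl big1 => [|i _]; last by rewrite /weight EW.
  rewrite /weight EW ES EE subn0 addn0 /=.
  have bb : b < 2 ^ b := ltn_expl b (isT : 1 < 2).
  have lb : trunc_log 2 (nb m b) <= b.+1.
    have <- : trunc_log 2 m.*2 = b.+1 by rewrite trunc_log2_double // ltnW.
    apply: leq_trunc_log; have := nb_le m b; lia.
  have le := leq_mul (leqnn (nb m b)) lb.
  apply: leq_trans le _; have d1 := leq_divM m b; have d2 := leq_div m b.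
  by rewrite /nb mulSn mulnS; lia.
by rewrite /potential; lia.
Qed.

Lemma wp_start Q k s :
  rg s 0 = n -> rg s 1 = m -> rg s 15 = b ->
  (forall x, 0 < x <= m -> ar s aLG x = trunc_log 2 x) ->
  (forall a j, 4 < a -> ar s a j = 0) -> 64 <= k ->
  (forall s', blocks m b (fun q => q == 0) s' ->
     potential m b (fun q => q == 0) s' <= 460 * m + 20 ->
     (forall a j, (0 < a < 4) || (8 < a) -> ar s' a j = ar s a j) ->
     rg s' 0 = n -> rg s' 1 = m -> rg s' 6 = 0 -> rg s' 7 = 0 -> Q (k - 64) s') ->
  wp start_blocks Q k s.
Proof.
move=> E0 E1 E15 EL EA Hk HQ; have [b0 bm] := log_m.
rewrite /start_blocks.
stp x Ex; rewrite /= E1 E15 in Ex.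
have xm : x <= m by rewrite Ex leq_div.
stp y Ey; rewrite /= Ex addn1 in Ey.
st. st. st. st. st. st. apply: wp_skip; set s' := setr _ 7 0.
have -> : k - 8 - 8 - 8 - 8 - 8 - 8 - 8 - 8 = k - 64 by clear -Hk; lia.
have [B P] : blocks m b (fun q => q == 0) s' /\ potential m b (fun q => q == 0) s' <= 460 * m + 20.
  apply: start_inv => //=.
  - by move=> j; rewrite EA //; case: j.
  - by move=> j; rewrite EA.
  - by move=> j; rewrite EA.
by apply: HQ => // a j Ha; do 9 (case: a Ha => [|a] //= Ha).
Qed.

End Main.

Section Body.
Variables (S : seq nat) (m : nat) (T : nat -> nat -> nat).
Variables (lab : nat -> seq nat) (ch : nat -> seq nat) (w : nat).
Hypothesis HS : end_marked S.
Hypothesis HT : stree S m T lab ch.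
Notation n := (size S).
Hypothesis Hw : 16 + n + 6 * m + 3 * n + 3 + 16 * (n + m + 2) < 2 ^ w.
Notation wp := (wp w n m (nth 0 S) T).
Notation b := (trunc_log 2 m).

(** Traversal, logarithms, start, initial potential with its expansion, insertions and reach
    pointers cost at most [200 m + 100], [60 m + 99], [64], [460 m + 120], [600 (n + 1)] and
    [300 (n + 1)]; [m <= 2 n] and [n > 0] leave the sum below [4900 n]. *)
Lemma wp_body : wp body (fun _ s =>
  (exists mk, heap_inv S m T lab ch n mk s) /\ forall i, 0 < i <= n -> reach_ok S s i)
  (4900 * n) (store0 n m).
Proof.
have m1 : 1 < m := m_gt1 HS HT; have m2 := m_le HS HT; have n0 := n_gt0 HS.
have [b0 bm] := log_m HS HT.
apply: wp_seq; apply: (wp_dfs (nth 0 S) HS HT Hw) => //; first by clear -m2 n0; lia.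
move=> s1 k1 K1 O1 P1 F1 A1 _ R1.
apply: wp_seq; apply: (wp_log_table (nth 0 S) T Hw) => //.
- by rewrite R1.
- by rewrite A1.
- by clear -K1 m2 n0; lia.
move=> s2 k2 K2 L2 A2 _ R20 R21 R215.
apply: wp_seq; apply: (wp_start HS HT Hw _ R21 R215 L2).
- by rewrite R20 R1.
- by move=> a j Ha; rewrite A2 ?A1 //; case: a Ha => [|[|[|[|[|a]]]]].
- by clear -K1 K2 m2 n0; lia.
move=> s3 B3 P3 A3 R30 R31 R36 R37.
have A31 a j : 0 < a < 4 -> ar s3 a j = ar s1 a j.
  by move=> Ha; rewrite A3 ?Ha // A2 //; case: a Ha => [|[|[|[|[|a]]]]].
have A30 a j : 8 < a -> ar s3 a j = 0.
  move=> Ha; rewrite A3 ?Ha ?orbT // A2; last by case: a Ha => [|[|[|[|[|a]]]]].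
  by rewrite A1 //; apply: leq_trans Ha.
have T3 : tables S m T lab ch s3.
  split=> //.
  - by move=> p Hp; rewrite A31 // O1.
  - by move=> v Hv; rewrite A31 // P1.
  - by move=> v Hv Lv; rewrite A31 // F1.
have rm := root_lt HS HT.
have num00 := num0 HS HT.
have numE v : v < m -> (num S lab ch v == 0) = (v == 0).
  move=> Hv; apply/eqP/eqP => [E|->]; last exact: num00.
  by apply: (num_inj HS HT Hv rm); rewrite E num00.
have K3 : 4900 * n <= k2 - 64 + 200 * m + 60 * m + 400 by clear -K1 K2 m2 n0; lia.
apply: wp_seq; apply: (wp_expand HS HT Hw b0 bm B3 T3 R37 R36 rm).
- by move=> c cv; have [/andP[c0 cm] _] := ch_bound HS HT rm cv; rewrite numE // (gtn_eqF c0).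
- by clear -K3 P3 m2 n0; lia.
move=> mk4 s4 k4 B4 M4 K4 L4 A4 _ R4.
have T4 : tables S m T lab ch s4.
  apply: tables_ext T3; [|by rewrite R4|by rewrite R4].
  by move=> a j Ha; rewrite A4 //; case: a Ha => [|[|[|[|[|a]]]]].
(* With the root alone in the heap, exactly the root and its children are marked, and the edges of
   these children hang empty from heap node 0. *)
have H4 : heap_inv S m T lab ch 0 mk4 s4.
  split.
  - move=> v Hv; rewrite M4 numE // [_ \in pheap S 0]inE.
    case: (posnP v) => [->//|v0] /=; have Hv' : 0 < v < m by rewrite v0.
    apply/mapP/eqP => [[c cv E]|E].
      have [/andP[c0 cm] pc] := ch_bound HS HT rm cv.
      by rewrite (num_inj HS HT Hv cm E) pc (lab0 HT).
    exists v => //; have := ch_mem HS HT Hv'; rewrite (lab_inj HT (par_lt HT Hv') rm) //.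
    by rewrite E (lab0 HT).
  - move=> v Hv; have /andP[v0 vm] := Hv; rewrite M4 numE // (gtn_eqF v0) /=.
    move=> /mapP[c cv E]; have [/andP[c0 cm] pc] := ch_bound HS HT rm cv.
    have {c cv c0 cm E pc} [pv vc] : T 0 v = 0 /\ v \in ch 0.
      by rewrite (num_inj HS HT vm cm E).
    rewrite pv (lab0 HT) L4 vc A4 // A30 //= take0; split=> // t0.
    rewrite [_ \in _]inE; apply/eqP => /(congr1 size); rewrite size_takel //.
    by have := edge_size HS HT Hv; rewrite pv (lab0 HT) => ->.
  - by move=> v Hv _; rewrite A4 // A30.
  - by case.
apply: wp_seq; apply: (wp_insert_all HS HT Hw b0 bm B4 T4 H4); first by rewrite R4.
  by clear -K3 K4 P3 m2 n0; lia.
move=> mk5 s5 k5 B5 T5 H5 K5.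
apply: (wp_reach_all HS HT Hw b0 bm B5 T5 H5); first by clear -K3 K4 K5 P3 m2 n0; lia.
by move=> s6 k6 H6 Hr; split=> //; exists mk5.
Qed.

End Body.

Lemma heap_output_of S m T lab ch mk s M :
  heap_inv S m T lab ch (size S) mk s -> (forall i, 0 < i <= size S -> reach_ok S s i) ->
  rel (size S) m (nth 0 S) T s M -> heap_output S M.
Proof.
move=> HI HR R; rewrite /heap_output /ph_label; cbv zeta => i Hi.
have /andP[i0 iN] := Hi; rewrite (rel_out R).
have [h1 h2 h3] := hi_out HI Hi; have [r1 r2 r3] := HR i Hi.
rewrite -[_ + 3 * i]addn0 (rel_ou R) // !addn0 !(rel_ou R) //.
by split=> //; split=> //; apply: leq_trans iN; apply: ltnW.
Qed.

Theorem theorem2 :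
  exists (P : seq instr) (c K : nat),
    forall (S : seq nat) (w m : nat) (M0 : nat -> nat),
      end_marked S ->
      K * (size S).+1 < 2 ^ w ->
      all (fun a => a < 2 ^ w) S ->
      suffix_tree_encoding S m M0 ->
      exists t, t <= c * size S /\
        halted P (run w P t (State 0 M0)) /\
        heap_output S (memory (run w P t (State 0 M0))).
Proof.
(* Addresses stay below [20 n + 22 m + 51 <= 64 n + 51], so 100 is enough for the word size. The ten
   instructions of [init] fit between [4900 n] and [5000 n] because [n > 0]. *)
exists program, 5000, 100 => S w m M0 HS Hw _ HE.
have [lab [ch HT]] := stree_of_encoding HE.
have m2 := m_le HS HT; have n0 := n_gt0 HS.
have Hw' : arrB (size S) m + 16 * (size S + m + 2) < 2 ^ w.
  by rewrite /arrB /outB; clear -Hw m2; lia.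
have C := code_at_whole program; rewrite {2}/program in C.
have [C1 /code_at_cat[C2 [C3 _]]] := code_at_cat C.
have [M1 E1 R1] := run_init HE Hw' C1.
have wfb : wf body by [].
have [t [M2 [s [k [E2 R2 [[mk HI] HR] L]]]]] := wp_sound Hw' wfb C2 R1 (wp_body HS HT Hw').
have E : run w program (size init + t) (State 0 M0) =
    State (0 + size init + size (comp (0 + size init) body)) M2 by rewrite iter_add_run E1.
exists (size init + t); rewrite E; split; last split.
- have -> : size init = 10 by []; by clear -L n0; lia.
- by rewrite /halted C3.
- exact: heap_output_of HI HR R2.
Qed.
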